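(* Let $k\ge 0$ be an integer, let $\Sigma_k$ denote either $RT_k$ or $BDM_{k+1}$, let $(\boldsymbol\sigma,u)\in H(\mathrm{div};\Omega)\times L^2(\Omega)$ be the solution of the mixed problem (M), and let $(\boldsymbol\sigma_h,u_h)\in\Sigma_k\times D_k$ be the solution of the discrete mixed problem (M$_h$). Then $$\|\alpha^{-1/2}(\boldsymbol\sigma-\boldsymbol\sigma_h)\|_{0,\Omega}\le \inf_{\boldsymbol\tau_h^f\in\Sigma_k^f}\|\alpha^{-1/2}(\boldsymbol\sigma-\boldsymbol\tau_h^f)\|_{0,\Omega},$$ where $\Sigma_k^f=\{\boldsymbol\tau_h\in\Sigma_k:\nabla\cdot\boldsymbol\tau_h=Q_h^kf\}$.
   Context: $\Omega\subset\mathbb R^d$ ($d=2$ or $3$) is a bounded polygonal (polyhedral) domain partitioned into open polygonal subdomains $\Omega_1,\dots,\Omega_n$; $\alpha$ is piecewise constant with $\alpha=\alpha_i>0$ on $\Omega_i$; $f\in L^2(\Omega)$. The problem is $-\nabla\cdot(\alpha\nabla u)=f$ in $\Omega$, $u=0$ on $\partial\Omega$, with flux $\boldsymbol\sigma=-\alpha\nabla u$. (M): find $(\boldsymbol\sigma,u)\in H(\mathrm{div};\Omega)\times L^2(\Omega)$ with $(\alpha^{-1}\boldsymbol\sigma,\boldsymbol\tau)-(\nabla\cdot\boldsymbol\tau,u)=0$ for all $\boldsymbol\tau\in H(\mathrm{div};\Omega)$ and $(\nabla\cdot\boldsymbol\sigma,v)=(f,v)$ for all $v\in L^2(\Omega)$.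 Here $(\cdot,\cdot)$ is the $L^2(\Omega)$ inner product and $\|\cdot\|_{0,\Omega}$ the $L^2(\Omega)$ norm. $\mathcal T$ is a regular (conforming, shape-regular) simplicial triangulation of $\Omega$ such that the interfaces $\partial\Omega_i\cap\partial\Omega_j$ do not cut through any element (so $\alpha$ is constant on each $K\in\mathcal T$). $P_k(K)$: polynomials on $K$ of total degree $\le k$. $D_k=\{v\in L^2(\Omega):v|_K\in P_k(K)\ \forall K\in\mathcal T\}$; $RT_k=\{\boldsymbol\tau\in H(\mathrm{div};\Omega):\boldsymbol\tau|_K\in P_k(K)^d+\mathbf xP_k(K)\ \forall K\in\mathcal T\}$; $BDM_{k}=\{\boldsymbol\tau\in H(\mathrm{div};\Omega):\boldsymbol\tau|_K\in P_{k}(K)^d\ \forall K\in\mathcal T\}$. $Q_h^k:L^2(\Omega)\to D_k$ is the $L^2$-projection. (M$_h$): find $(\boldsymbol\sigma_h,u_h)\in\Sigma_k\times D_k$ with $(\alpha^{-1}\boldsymbol\sigma_h,\boldsymbol\tau_h)-(\nabla\cdot\boldsymbol\tau_h,u_h)=0$ for all $\boldsymbol\tau_h\in\Sigma_k$ and $(\nabla\cdot\boldsymbol\sigma_h,v_h)=(f,v_h)$ for all $v_h\in D_k$. *)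

(* Defs.v *)
From HB Require Import structures.
From mathcomp Require Import all_boot all_order all_algebra.
(* The notations of mpoly clash with those of mathcomp-analysis. *)
From mathcomp Require Import -(notations) mpoly.
From mathcomp Require Import all_classical all_reals all_analysis.

Set Implicit Arguments.
Unset Strict Implicit.
Unset Printing Implicit Defensive.

Import Order.TTheory GRing.Theory Num.Theory.
Import numFieldNormedType.Exports.

Local Open Scope classical_set_scope.
Local Open Scope ring_scope.

(* The sigma-algebra on 'rV[R]_d generated by the coordinate projections, i.e.
   the Borel sigma-algebra, in the same way as the library does for tuples. *)
Section row_measurable.
Context {R : realType}.
Variable d : nat.

Let coor (i : 'I_d) (x : 'rV[R]_d) : measurableTypeR R := x 0 i.

Let row_set0 : g_sigma_preimage coor set0.
Proof. exact: sigma_algebra0. Qed.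

Let row_setC A : g_sigma_preimage coor A -> g_sigma_preimage coor (~` A).
Proof. exact: sigma_algebraC. Qed.

Let row_bigcup (F : _^nat) : (forall i, g_sigma_preimage coor (F i)) ->
  g_sigma_preimage coor (\bigcup_i (F i)).
Proof. exact: sigma_algebra_bigcup. Qed.

HB.instance Definition _ := @isMeasurable.Build
  (measure_tuple_display (R.-ocitv.-measurable).-sigma) 'rV[R]_d
  (g_sigma_preimage coor) row_set0 row_setC row_bigcup.

Lemma measurable_coor (i : 'I_d) : measurable_fun [set: 'rV[R]_d] (coor i).
Proof.
move=> _ Y mY; rewrite setTI; apply: sub_sigma_algebra => /=.
rewrite -bigcup_seq/=; exists i => /=; first by rewrite mem_index_enum.
by exists Y => //; rewrite setTI.
Qed.

Lemma measurable_fun_coorP d1 (T : measurableType d1) (f : T -> 'rV[R]_d) :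
  (forall i, measurable_fun [set: T] (coor i \o f)) ->
  measurable_fun [set: T] f.
Proof.
move=> mf; suff H : g_sigma_preimage (fun i => coor i \o f) `<=` measurable.
  by move=> _ A mA; apply: H; rewrite g_sigma_preimage_comp; exists A.
apply: smallest_sub; first exact: sigma_algebra_measurable.
by move=> A; rewrite -bigcup_seq => -[i _ [B mB <-]]; exact: mf.
Qed.

End row_measurable.

Section lebesgue_rV.
Context {R : realType}.

(* The point (p.2, p.1_0, ..., p.1_(d-1)) of R^(d+1). *)
Definition cons_rV d (p : 'rV[R]_d * measurableTypeR R) : 'rV[R]_d.+1 :=
  row_mx (p.2 : R)%:M p.1.

Lemma measurable_cons_rV d :
  measurable_fun [set: 'rV[R]_d * measurableTypeR R] (@cons_rV d).
Proof.
apply: measurable_fun_coorP => i.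
have [j|j] := split_ordP (i : 'I_(1 + d)) => -> /=.
  rewrite (_ : _ \o _ = snd)//; apply/funext => p /=.
  by rewrite /cons_rV -[LHS]/(row_mx _ _ _ _) row_mxEl mxE ord1 eqxx mulr1n.
rewrite (_ : _ \o _ = (fun x : 'rV[R]_d => x 0 j) \o fst).
  by apply: measurableT_comp => //; exact: measurable_coor.
by apply/funext => p /=; rewrite /cons_rV -[LHS]/(row_mx _ _ _ _) row_mxEr.
Qed.

(* One-dimensional Lebesgue measure is the right factor of the product because
   the library's product of measures requires sigma-finiteness on the right. *)
Fixpoint lebesgue_rV d : set 'rV[R]_d -> \bar R :=
  if d is n.+1 then
    pushforward (@lebesgue_rV n \x @lebesgue_measure R)%E (@cons_rV n)
  else dirac (0 : 'rV[R]_0).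

Let is_measure d :
  exists m : {measure set 'rV[R]_d -> \bar R}, @lebesgue_rV d = m.
Proof.
elim: d => [|d [m IH]] /=; first by exists (dirac (0 : 'rV[R]_0)).
rewrite IH; have mf := @measurable_cons_rV d.
pose m' : {measure set ('rV[R]_d * measurableTypeR R) -> \bar R} :=
  (m \x @lebesgue_measure R)%E.
rewrite -[(m \x _)%E]/(m' : _ -> _).
have m0 : pushforward m' (@cons_rV d) set0 = 0%E by exact: measure0.
have m_ge0 A : (0 <= pushforward m' (@cons_rV d) A)%E by exact: measure_ge0.
have m_add : semi_sigma_additive (pushforward m' (@cons_rV d)).
  exact: measure_semi_sigma_additive.
move: (pushforward m' _) m0 m_ge0 m_add => nu nu0 nu_ge0 nu_add.
by exists (HB.pack_for {measure set 'rV[R]_d.+1 -> \bar R} nu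
  (isMeasure.Build _ _ _ nu nu0 nu_ge0 nu_add)).
Qed.

Let lebesgue_rV0 d : @lebesgue_rV d set0 = 0%E.
Proof. by have [m ->] := is_measure d; exact: measure0. Qed.

Let lebesgue_rV_ge0 d A : (0 <= @lebesgue_rV d A)%E.
Proof. by have [m ->] := is_measure d; exact: measure_ge0. Qed.

Let lebesgue_rV_additive d : semi_sigma_additive (@lebesgue_rV d).
Proof.
by have [m ->] := is_measure d; exact: measure_semi_sigma_additive.
Qed.

HB.instance Definition _ d := isMeasure.Build _ _ _ (@lebesgue_rV d)
  (@lebesgue_rV0 d) (@lebesgue_rV_ge0 d) (@lebesgue_rV_additive d).

End lebesgue_rV.
Arguments lebesgue_rV {R} d.

Section polyhedra.
Context {R : realType} {d : nat}.
Implicit Types (x y : 'rV[R]_d) (A Om : set 'rV[R]_d).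

Definition enorm x : R := Num.sqrt (\sum_(i < d) x 0 i ^+ 2).

Definition aff_independent m (v : 'I_m -> 'rV[R]_d) :=
  forall c : 'I_m -> R, \sum_(i < m) c i = 0 -> \sum_(i < m) c i *: v i = 0 ->
    forall i, c i = 0.

Definition convex_hull A : set 'rV[R]_d :=
  [set x | exists m (v : 'I_m -> 'rV[R]_d) (c : 'I_m -> R),
    [/\ forall i, A (v i), forall i, 0 <= c i, \sum_(i < m) c i = 1 &
        x = \sum_(i < m) c i *: v i]].

(* A bounded domain whose boundary is a finite union of (d-1)-simplices:
   segments in the plane, triangles in space.  A slit along such a simplex
   is not excluded. *)
Definition polyhedral_domain Om :=
  [/\ Om !=set0, open Om, connected Om, bounded_set Om &
      exists N (F : 'I_N -> 'I_d -> 'rV[R]_d),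
        (forall j, aff_independent (F j)) /\
        closure Om `\` interior Om = \bigcup_j convex_hull (range (F j))].

Definition polyhedral_partition Om n (Omi : 'I_n -> set 'rV[R]_d) :=
  [/\ forall i, polyhedral_domain (Omi i),
      forall i, Omi i `<=` Om,
      forall i j, i != j -> Omi i `&` Omi j = set0 &
      closure Om = \bigcup_i closure (Omi i)].

(* A mesh is a finite family of simplices, each given by its d+1 vertices.  Its
   elements are open sets, like the subdomains. *)
Definition mesh N := 'I_N -> 'I_d.+1 -> 'rV[R]_d.

Definition elt N (T : mesh N) (j : 'I_N) : set 'rV[R]_d :=
  interior (convex_hull (range (T j))).

(* Conformity: two closed simplices meet in the (possibly empty) face spanned by
   their common vertices. *)
Definition triangulation Om N (T : mesh N) :=
  [/\ forall j, aff_independent (T j),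
      forall i j, i != j -> elt T i `&` elt T j = set0,
      forall i j, convex_hull (range (T i)) `&` convex_hull (range (T j)) =
        convex_hull (range (T i) `&` range (T j)),
      forall j, elt T j `<=` Om &
      closure Om = \bigcup_j convex_hull (range (T j))].

Definition diameter A : R := sup [set enorm (p.1 - p.2) | p in A `*` A].

Definition indiameter A : R :=
  sup [set r *+ 2 | r in
    [set r : R | 0 < r /\ exists c, forall y, enorm (y - c) < r -> A y]].

Definition shape_regular (kappa : R) N (T : mesh N) :=
  forall j, diameter (elt T j) <= kappa * indiameter (elt T j).

Definition resolves_interfaces n (Omi : 'I_n -> set 'rV[R]_d) N (T : mesh N) :=
  forall i j, i != j ->
    forall l, elt T l `&`
      ((closure (Omi i) `\` interior (Omi i)) `&`
       (closure (Omi j) `\` interior (Omi j))) = set0.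

(* The value is 0 on the null set outside the subdomains. *)
Definition piecewise_cst n (Omi : 'I_n -> set 'rV[R]_d) (a : 'I_n -> R) x : R :=
  \sum_(i < n) a i * \1_(Omi i) x.

End polyhedra.

Section function_spaces.
Context {R : realType} {d : nat}.
Variable Om : set 'rV[R]_d.
Implicit Types (f g u v : 'rV[R]_d -> R) (s t : 'rV[R]_d -> 'rV[R]_d).

Definition L2 : set ('rV[R]_d -> R) :=
  [set f | f \_ Om \in Lfun (lebesgue_rV d) 2%:E].

Definition L2vec : set ('rV[R]_d -> 'rV[R]_d) :=
  [set s | forall i, L2 (fun x => s x 0 i)].

Definition dot (x y : 'rV[R]_d) : R := \sum_(i < d) x 0 i * y 0 i.

Definition inner f g : R := \int[lebesgue_rV d]_(x in Om) (f x * g x).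

Definition vinner s t : R := \int[lebesgue_rV d]_(x in Om) dot (s x) (t x).

Definition vnorm s : R := Num.sqrt (vinner s s).

(* The norm ||alpha^(-1/2) s||_(0, Om). *)
Definition weighted_norm (alpha : 'rV[R]_d -> R) s : R :=
  vnorm (fun x => (Num.sqrt (alpha x))^-1 *: s x).

Definition partial (i : 'I_d) f : 'rV[R]_d -> R :=
  fun x => 'D_(delta_mx 0 i) f x.

Definition gradient f : 'rV[R]_d -> 'rV[R]_d :=
  fun x => \row_(i < d) partial i f x.

Fixpoint class_C (m : nat) f : Prop :=
  if m is m'.+1 then
    continuous f /\
    forall i, (forall x, derivable f x (delta_mx 0 i)) /\
      class_C m' (partial i f)
  else continuous f.

Definition test_function f :=
  [/\ forall m, class_C m f,
      compact (closure [set x | f x != 0]) &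
      closure [set x | f x != 0] `<=` Om].

Definition is_divergence s g :=
  L2 g /\
  forall phi, test_function phi -> vinner s (gradient phi) = - inner g phi.

Definition Hdiv : set ('rV[R]_d -> 'rV[R]_d) :=
  [set s | L2vec s /\ exists g, is_divergence s g].

(* A representative of the distributional divergence of s, for s in H(div). *)
Definition weak_div s : 'rV[R]_d -> R := xget (cst 0) [set g | is_divergence s g].

Variables (N : nat) (T : @mesh R d N).

Definition peval (p : mpoly d R) (x : 'rV[R]_d) : R :=
  meval (fun i => x 0 i) p.

Definition total_degree_le (k : nat) (p : mpoly d R) :=
  (mmeasure mdeg p <= k.+1)%N.

Definition Dh (k : nat) : set ('rV[R]_d -> R) :=
  [set v | L2 v /\ forall j, exists2 p, total_degree_le k p &
     {ae lebesgue_rV d, forall x, elt T j x -> v x = peval p x}].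

Definition RT (k : nat) : set ('rV[R]_d -> 'rV[R]_d) :=
  [set t | Hdiv t /\ forall j,
     exists (p : 'I_d -> mpoly d R) (q : mpoly d R),
     [/\ forall i, total_degree_le k (p i), total_degree_le k q &
       {ae lebesgue_rV d, forall x, elt T j x ->
          t x = \row_(i < d) peval (p i) x + peval q x *: x}]].

Definition BDM (k : nat) : set ('rV[R]_d -> 'rV[R]_d) :=
  [set t | Hdiv t /\ forall j, exists2 p : 'I_d -> mpoly d R,
     forall i, total_degree_le k (p i) &
     {ae lebesgue_rV d, forall x, elt T j x ->
        t x = \row_(i < d) peval (p i) x}].

(* A representative of the L^2-projection of f onto Dh k. *)
Definition Qh (k : nat) f : 'rV[R]_d -> R :=
  xget (cst 0)
    [set q | Dh k q /\ forall v, Dh k v -> inner q v = inner f v].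

Definition Sigma_f (Sigma : set ('rV[R]_d -> 'rV[R]_d)) (k : nat) f :=
  [set t | Sigma t /\
     {ae lebesgue_rV d, forall x, Om x -> weak_div t x = Qh k f x}].

(* The continuous problem is X = H(div), Y = L^2, the discrete one is
   X = Sigma_k, Y = D_k. *)
Definition mixed_solution (X : set ('rV[R]_d -> 'rV[R]_d))
    (Y : set ('rV[R]_d -> R)) (alpha f : 'rV[R]_d -> R)
    (s : 'rV[R]_d -> 'rV[R]_d) (u : 'rV[R]_d -> R) :=
  [/\ X s, Y u,
      forall t, X t ->
        vinner (fun x => (alpha x)^-1 *: s x) t - inner (weak_div t) u = 0 &
      forall v, Y v -> inner (weak_div s) v = inner f v].

End function_spaces.

(* Main.v *)
(** Let [e = t - sh] with [t] in [Sigma] and [div t = Qh f].  Since [div sh] is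
    piecewise polynomial of degree at most [k], the second discrete equation
    says that [div sh = Qh f], so [div e = 0].  Testing both first equations
    with [e] then gives [(alpha^-1 (s - sh), e) = 0], and the claim is
    Pythagoras' theorem for [s - t = (s - sh) - e].

    With divergences defined weakly, this requires the weak divergence to be
    unique, and to agree with the classical one where the field is polynomial.
    For both it is enough to test with products of one-dimensional bumps, which
    increase to indicators of boxes: boxes generate the Borel sets, and
    integration by parts against such a product reduces, monomial by monomial,
    to the fundamental theorem of calculus in one variable. *)

Require Import Defs.
From HB Require Import structures.
From mathcomp Require Import all_boot all_order all_algebra.
From mathcomp Require Import -(notations) mpoly.
From mathcomp Require Import ring.
From mathcomp Require Import all_classical all_reals all_analysis.
From mathcomp Require Import measurable_realfun.

Set Implicit Arguments.
Unset Strict Implicit.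
Unset Printing Implicit Defensive.

Import Order.TTheory GRing.Theory Num.Theory.
Import numFieldNormedType.Exports.

Local Open Scope classical_set_scope.
Local Open Scope ring_scope.

(** * Boxes and Lebesgue measure *)

Section boxes.
Context {R : realType} {d : nat}.
Implicit Types (a b x : 'rV[R]_d) (A : set 'rV[R]_d).

Definition obox a b := [set x : 'rV[R]_d | forall i, x 0 i \in `]a 0 i, b 0 i[].

Definition cbox a b := [set x : 'rV[R]_d | forall i, x 0 i \in `[a 0 i, b 0 i]].

Lemma obox_cbox a b : obox a b `<=` cbox a b.
Proof. by move=> x xab i; apply: subset_itv_oo_cc (xab i). Qed.

Lemma compact_cbox a b : compact (cbox a b).
Proof.
apply: (@rV_compact R d (fun i => `[a 0 i, b 0 i]%classic)) => i.
exact: segment_compact.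
Qed.

Lemma closed_cbox a b : closed (cbox a b).
Proof. by apply: compact_closed; [exact: norm_hausdorff|exact: compact_cbox]. Qed.

Lemma measurable_obox a b : measurable (obox a b).
Proof.
rewrite (_ : obox a b =
    \bigcap_(i in [set: 'I_d]) ((fun x => x 0 i) @^-1` `]a 0 i, b 0 i[)).
  apply: fin_bigcap_measurable => // i _.
  by rewrite -[_ @^-1` _]setTI; exact: measurable_coor.
by apply/seteqP; split=> x /= h i; [move=> _|]; exact: h.
Qed.

(** Rational corners give a countable family of boxes. *)
Definition rat_row (q : 'rV[rat]_d) : 'rV[R]_d := map_mx ratr q.

(** Each point of [A] has a ball inside [A], and rational numbers on both sides of each coordinate
    give a box in that ball. The closed boxes are required to lie in [A] because bumps are supported
    in closed boxes. *)
Lemma open_bigcup_box A : open A ->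
  A = \bigcup_(p in [set p : 'rV[rat]_d * 'rV[rat]_d |
        cbox (rat_row p.1) (rat_row p.2) `<=` A])
      obox (rat_row p.1) (rat_row p.2).
Proof.
move=> oA; apply/seteqP; split => [x Ax|x [p /= pA px]]; last first.
  exact/pA/obox_cbox.
have /nbhs_ballP [e /= e0 xeA] : nbhs x A by exact: open_nbhs_nbhs.
have ltl i : x 0 i - e < x 0 i by rewrite ltrBlDr ltrDl.
have ltr i : x 0 i < x 0 i + e by rewrite ltrDl.
have [q1 q1P] := choice (fun i => rat_in_itvoo (ltl i)).
have [q2 q2P] := choice (fun i => rat_in_itvoo (ltr i)).
exists (\row_i q1 i, \row_i q2 i) => /=; last first.
  move=> i; rewrite !mxE in_itv/=.
  by move: (q1P i) (q2P i); rewrite !in_itv/= => /andP[_ ->] /andP[-> _].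
move=> y /= yq; apply: xeA; split => // i j; rewrite (ord1 i) /ball/=.
move: (yq j) (q1P j) (q2P j); rewrite !mxE !in_itv/= => /andP[y1 y2].
move=> /andP[h1 h2] /andP[h3 h4]; rewrite ltr_distlC.
by apply/andP; split; [exact: lt_le_trans y1|exact: le_lt_trans h4].
Qed.

Lemma open_measurable_rV A : open A -> measurable A.
Proof.
move=> /open_bigcup_box ->; rewrite bigcup_mkcond.
apply: countable_bigcupT_measurable => // p.
by case: ifP => _; [exact: measurable_obox|exact: measurable0].
Qed.

Lemma closed_measurable_rV A : closed A -> measurable A.
Proof.
move=> /closed_openC/open_measurable_rV/measurableC.
by rewrite setCK.
Qed.

Lemma continuous_measurable_rV (f : 'rV[R]_d -> R) :
  continuous f -> measurable_fun setT f.
Proof.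
move=> /continuousP cf.
apply: (measurability _ (RGenOInfty.measurableE R)).
move=> _ [_ [r ->] <-]; rewrite setTI; apply: open_measurable_rV.
apply: cf; exact: interval_open.
Qed.

Lemma measurable_cbox a b : measurable (cbox a b).
Proof. by apply: closed_measurable_rV; exact: closed_cbox. Qed.

(** Boxes as generators are what Dynkin's theorem needs below. The sigma-algebra is defined by
    coordinates, so it is enough to obtain the half-spaces [x_i > r] from boxes. *)
Lemma measurable_rV_obox :
  (@measurable _ 'rV[R]_d) = <<s [set obox p.1 p.2 | p in [set: 'rV[R]_d * 'rV[R]_d]] >>.
Proof.
apply/seteqP; split; last first.
  apply: smallest_sub; first exact: sigma_algebra_measurable.
  by move=> _ [p _ <-]; exact: measurable_obox.
apply: smallest_sub; first exact: smallest_sigma_algebra.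
move=> A; rewrite -bigcup_seq => -[i _ [B mB <-]] {A}.
pose G := [set obox p.1 p.2 | p in [set: 'rV[R]_d * 'rV[R]_d]].
suff : measurable_fun setT ((fun x => x 0 i) :
    g_sigma_algebraType G -> measurableTypeR R) by exact.
apply: (measurability _ (RGenOInfty.measurableE R)).
move=> _ [_ [r ->] <-]; rewrite setTI.
(* The half-space is the union of boxes bounded below by [r] in direction [i] and by [-n] in the
   others, and above by [n]. *)
rewrite (_ : _ @^-1` _ = \bigcup_n obox
    (\row_j if j == i then r else - n%:R) (const_mx n%:R)).
  apply: bigcupT_measurable => n; apply: sub_sigma_algebra.
  by eexists (_, _).
apply/seteqP; split => x /=; last first.
  by move=> [n _ /(_ i)]; rewrite !mxE eqxx !in_itv/= andbT => /andP[].
(* The sum of the absolute values dominates every coordinate, so one [n] serves all of them. *)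
rewrite in_itv/= andbT => rx; exists (Num.bound (\sum_j `|x 0 j|)) => //= j.
have xj : `|x 0 j| < (Num.bound (\sum_j `|x 0 j|))%:R.
  apply: le_lt_trans (archi_boundP _); last exact: sumr_ge0.
  by rewrite (bigD1 j)//= lerDl; exact: sumr_ge0.
move: xj; rewrite ltr_norml => /andP[x1 x2]; rewrite !mxE in_itv/= x2 andbT.
by case: eqP => [->|].
Qed.

(** Take the larger of the lower corners and the smaller of the upper ones. The inclusion of closed
    boxes keeps the bumps of the intersection supported in the first box. *)
Lemma oboxI a b a' b' : exists a'' b'',
  [/\ obox a b `&` obox a' b' = obox a'' b'' & cbox a'' b'' `<=` cbox a b].
Proof.
exists (\row_i Num.max (a 0 i) (a' 0 i)), (\row_i Num.min (b 0 i) (b' 0 i)).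
split; last first.
  move=> x h i; move: (h i); rewrite !mxE !in_itv/= ge_max le_min.
  by move=> /andP[/andP[-> _] /andP[-> _]].
apply/seteqP; split => [x [h1 h2] i|x h].
  move: (h1 i) (h2 i); rewrite !mxE !in_itv/= gt_max lt_min.
  by move=> /andP[-> ->] /andP[-> ->].
by split => i; move: (h i); rewrite !mxE !in_itv/= gt_max lt_min;
  move=> /andP[/andP[? ?] /andP[? ?]]; apply/andP.
Qed.

Lemma obox_setI_closed :
  setI_closed [set obox p.1 p.2 | p in [set: 'rV[R]_d * 'rV[R]_d]].
Proof.
move=> _ _ [[a b] _ <-] [[a' b'] _ <-] /=.
by have [a'' [b'' [-> _]]] := oboxI a b a' b'; exists (a'', b'').
Qed.

End boxes.

(** * Finiteness on bounded sets and Fubini's theorem for [lebesgue_rV] *)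

Section lebesgue_rV_theory.
Context {R : realType}.

Lemma cons_rV_ord0 d (p : 'rV[R]_d * measurableTypeR R) :
  cons_rV p 0 ord0 = p.2 :> R.
Proof.
rewrite /cons_rV (_ : ord0 = lshift d ord0 :> 'I_(1 + d)); last exact: val_inj.
by rewrite -[LHS]/(row_mx _ _ _ _) row_mxEl mxE eqxx mulr1n.
Qed.

Lemma cons_rV_lift d (p : 'rV[R]_d * measurableTypeR R) i :
  cons_rV p 0 (lift ord0 i) = p.1 0 i :> R.
Proof.
rewrite /cons_rV (_ : lift ord0 i = rshift 1 i :> 'I_(1 + d)).
  by rewrite -[LHS]/(row_mx _ _ _ _) row_mxEr.
exact: val_inj.
Qed.

Lemma lebesgue_rV_cbox d (a b : 'rV[R]_d) :
  (lebesgue_rV d (cbox a b) < +oo)%E.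
Proof.
elim: d a b => [|d IH] a b /=; first by rewrite diracE ltry.
pose a' : 'rV_d := \row_i a 0 (lift ord0 i).
pose b' : 'rV_d := \row_i b 0 (lift ord0 i).
(* Splitting off the first coordinate turns a box into a product, whose measure is a product of
   finite numbers. *)
rewrite /pushforward (_ : _ @^-1` _ = cbox a' b' `*` `[a 0 ord0, b 0 ord0]).
  rewrite product_measure1E//; last first.
    exact: measurable_cbox.
  rewrite lte_mul_pinfty// ?ge0_fin_numE// ?IH//.
  suff : (lebesgue_measure (`[(a 0 ord0)%R, (b 0 ord0)%R]%classic : set R) < +oo)%E by [].
  by rewrite lebesgue_measure_itv/=; case: ifP; rewrite ltry.
apply/seteqP; split => [p /= h|p /= [h1 h2] i].
  split; last by have := h ord0; rewrite cons_rV_ord0.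
  by move=> i; have := h (lift ord0 i); rewrite cons_rV_lift !mxE.
case: (unliftP ord0 i) => [j ->|->]; rewrite ?cons_rV_ord0 ?cons_rV_lift//.
by have := h1 j; rewrite !mxE.
Qed.

Lemma cbox_bound d (x : 'rV[R]_d) (M : R) : `|x| <= M ->
  cbox (const_mx (- M)) (const_mx M) x.
Proof.
move=> xM i; rewrite !mxE in_itv/= -ler_norml; apply: le_trans xM.
rewrite [`|x|]mx_normrE.
exact: (le_bigmax _ (fun ij => `|x ij.1 ij.2|) (0, i)).
Qed.

Lemma sigma_finite_lebesgue_rV d : sigma_finite [set: 'rV[R]_d] (lebesgue_rV d).
Proof.
exists (fun n => cbox (const_mx (- n%:R)) (const_mx n%:R)) => [|n]; last first.
  by split; [exact: measurable_cbox|exact: lebesgue_rV_cbox].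
apply/seteqP; split=> // x _; exists (Num.bound `|x|) => //.
by apply: cbox_bound; exact/ltW/archi_boundP.
Qed.

(** Fubini's theorem is applied below with [lebesgue_rV d] as a factor. *)
HB.instance Definition _ d := Measure_isSigmaFinite.Build _ _ _
  (@lebesgue_rV R d) (@sigma_finite_lebesgue_rV d).

Lemma lebesgue_rV_bounded d (A : set 'rV[R]_d) :
  measurable A -> bounded_set A -> (lebesgue_rV d A < +oo)%E.
Proof.
move=> mA [M [_ bA]]; pose r := M + 1.
apply: le_lt_trans (lebesgue_rV_cbox (const_mx (- r)) (const_mx r)).
apply: le_measure; rewrite ?inE//; first exact: measurable_cbox.
by move=> x Ax; apply: cbox_bound; apply: bA Ax; rewrite ltrDl.
Qed.

Local Open Scope ereal_scope.

(** [lebesgue_rV d.+1] is by definition the image of a product measure under [cons_rV], so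
    integrability can be checked on the product. *)
Lemma integrable_lebesgue_rVS d (f : 'rV[R]_d.+1 -> R) :
  (lebesgue_rV d \x @lebesgue_measure R).-integrable setT
    (EFin \o (f \o @cons_rV R d)) ->
  measurable_fun setT f ->
  (lebesgue_rV d.+1).-integrable setT (EFin \o f).
Proof.
move=> fi mf.
pose mu : {measure set _ -> \bar R} := (lebesgue_rV d \x @lebesgue_measure R).
change ((pushforward mu (@cons_rV R d)).-integrable setT (EFin \o f)).
apply: (@integrable_pushforward _ _ _ _ _ _ (measurable_cons_rV (d := d)) mu) => //.
exact/measurable_EFinP.
Qed.

Lemma integral_lebesgue_rVS d (f : 'rV[R]_d.+1 -> R) :
  (lebesgue_rV d \x @lebesgue_measure R).-integrable setT
    (EFin \o (f \o @cons_rV R d)) ->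
  measurable_fun setT f ->
  \int[lebesgue_rV d.+1]_x (f x)%:E =
  \int[lebesgue_rV d]_y \int[lebesgue_measure]_x (f (cons_rV (y, x)))%:E.
Proof.
move=> fi mf.
rewrite (integral12_prod_meas1 (f := fun p => (f (cons_rV p))%:E))//.
pose mu : {measure set _ -> \bar R} := (lebesgue_rV d \x @lebesgue_measure R).
change (\int[pushforward mu (@cons_rV R d)]_x (f x)%:E =
  \int[mu]_p ((EFin \o f) \o @cons_rV R d) p).
apply: (@integral_pushforward _ _ _ _ _ _ (measurable_cons_rV (d := d)) mu) => //.
exact/measurable_EFinP.
Qed.

(** Induction on [d] with Fubini's theorem, splitting off the first coordinate. For [d = 0] the
    empty product 1 is integrated against a Dirac mass. *)
Lemma integral_lebesgue_rV_prod d (F : 'I_d -> R -> R) :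
  (forall i, (@lebesgue_measure R).-integrable setT (EFin \o F i)) ->
  (lebesgue_rV d).-integrable setT
    (EFin \o (fun x : 'rV[R]_d => \prod_i F i (x 0 i))%R) /\
  \int[lebesgue_rV d]_x (\prod_i F i (x 0%R i))%:E =
    (\prod_i \int[lebesgue_measure]_x F i x)%:E.
Proof.
elim: d F => [|d IH] F Fi.
  have I1 : \int[lebesgue_rV 0]_(x in [set: 'rV[R]_0]) cst 1 x = 1.
    rewrite (integral_cst (lebesgue_rV 0) measurableT) mul1e.
    by rewrite [LHS]diracE in_setT.
  have E : EFin \o (fun x : 'rV[R]_0 => \prod_i F i (x 0 i))%R = cst 1.
    by apply/funext => x /=; rewrite big_ord0.
  rewrite big_ord0; split.
    rewrite -[X in integrable _ _ X]/(EFin \o _) E; apply/integrableP; split => //.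
    under eq_integral do rewrite /= normr1.
    by rewrite I1 ltry.
  under eq_integral do rewrite big_ord0.
  exact: I1.
have [I1 I2] := IH _ (fun i => Fi (lift ord0 i)).
have mF i : measurable_fun setT (F i).
  by apply/measurable_EFinP; exact: measurable_int (Fi i).
have mP : measurable_fun setT (fun x : 'rV[R]_d.+1 => \prod_i F i (x 0 i))%R.
  apply: measurable_prod => i _.
  by apply: (measurableT_comp (mF i)); exact: measurable_coor.
pose H (y : 'rV[R]_d) := (\prod_i F (lift ord0 i) (y 0 i))%R.
have PE p : (\prod_i F i (cons_rV p 0 i) = F ord0 p.2 * H p.1)%R.
  rewrite big_ord_recl cons_rV_ord0; congr (_ * _)%R.
  by apply: eq_bigr => i _; rewrite cons_rV_lift.
have mP' : measurable_fun setT
    (EFin \o ((fun x : 'rV[R]_d.+1 => \prod_i F i (x 0 i))%R \o @cons_rV R d)).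
  by apply/measurable_EFinP; apply: measurableT_comp => //; exact: measurable_cons_rV.
have iP : (lebesgue_rV d \x @lebesgue_measure R).-integrable setT
    (EFin \o ((fun x : 'rV[R]_d.+1 => \prod_i F i (x 0 i))%R \o @cons_rV R d)).
  (* The iterated integral of the absolute value factors into the integrals of [|H|] and of
     [|F ord0|], both finite. *)
  apply/(integrable12ltyP _ _ mP').
  have /integrableP[_ F0y] := Fi ord0; have /integrableP[mH Hy] := I1.
  rewrite (eq_integral (fun y =>
    `|(H y)%:E| * \int[lebesgue_measure]_x `|(F ord0 x)%:E|)); last first.
    move=> y _; rewrite -ge0_integralZl//.
      by apply: eq_integral => x _; rewrite /= PE normrM mulrC EFinM.
    by apply: (@measurableT_comp _ _ _ _ _ _ (@abse R)) => //;
      exact: measurable_int (Fi _).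
  rewrite ge0_integralZr//.
  - apply: lte_mul_pinfty; [exact: integral_ge0| |exact: F0y].
    by rewrite ge0_fin_numE ?integral_ge0//; exact: Hy.
  - by apply: (@measurableT_comp _ _ _ _ _ _ (@abse R)).
  - exact: integral_ge0.
split; first exact: integrable_lebesgue_rVS.
rewrite integral_lebesgue_rVS//.
rewrite (eq_integral (fun y =>
  (H y)%:E * \int[lebesgue_measure]_x (F ord0 x)%:E)); last first.
  move=> y _; rewrite -integralZl//; last exact: Fi.
  by apply: eq_integral => x _; rewrite /= PE mulrC EFinM.
rewrite /= big_ord_recl mulrC EFinM -I2.
have F0 : \int[lebesgue_measure]_x (F ord0 x)%:E \is a fin_num.
  by apply: integrable_fin_num => //; exact: Fi.
by rewrite -(fineK F0) integralZr// mulrC.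
Qed.

End lebesgue_rV_theory.

(** * Smooth bumps *)

Section flat.
Context {R : realType}.
Implicit Types (p : {poly R}) (x y : R).

(* This family is stable by derivation, hence consists of smooth functions. *)
Definition flat p x : R := if 0 < x then p.[x^-1] * expR (- x^-1) else 0.

Lemma flat_le0 p x : x <= 0 -> flat p x = 0.
Proof. by rewrite /flat; case: ltP. Qed.

Lemma flatZ p c x : flat (c *: p) x = c * flat p x.
Proof. by rewrite /flat; case: ifP; rewrite ?mulr0// hornerZ mulrA. Qed.

(** Raise [y / n <= exp (y / n)] to the power [n]; for [n = 0] the factor [0 ^ 0] is 1. *)
Lemma exprn_le_expR n y : 0 <= y -> y ^+ n <= n%:R ^+ n * expR y.
Proof.
move=> y0; case: n => [|n]; first by rewrite !expr0 mul1r -expR0 ler_expR.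
have n0 : 0 < n.+1%:R :> R by [].
have : y / n.+1%:R <= expR (y / n.+1%:R).
  by apply: le_trans (expR_ge1Dx _); rewrite lerDr.
move=> /(lerXn2r n.+1); rewrite !nnegrE expR_ge0 divr_ge0// => /(_ isT isT).
rewrite -expRM_natl mulrCA divff ?gt_eqF// mulr1 expr_div_n ler_pdivrMr ?exprn_gt0//.
by rewrite mulrC.
Qed.

Lemma horner_le_expR p : exists C, forall y, 0 <= y -> `|p.[y]| <= C * expR y.
Proof.
exists (\sum_(i < size p) `|p`_i| * i%:R ^+ i) => y y0.
rewrite horner_coef mulr_suml; apply: le_trans (ler_norm_sum _ _ _) _.
apply: ler_sum => i _; rewrite normrM -mulrA ler_wpM2l// normrX ger0_norm//.
exact: exprn_le_expR.
Qed.

(** The exponential dominates [y^2 p(y)]; at [y = 1/x] the extra square becomes the factor [x^2].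
    This order of vanishing makes [flat p] differentiable at 0 with derivative 0. *)
Lemma flat_le_sqr p : exists C, forall x, `|flat p x| <= C * x ^+ 2.
Proof.
have [C PC] := horner_le_expR ('X^2 * p).
have C0 : 0 <= C.
  by have := le_trans (normr_ge0 _) (PC 0 (lexx _)); rewrite expR0 mulr1.
exists C => x; rewrite /flat; case: ifPn => [x0|_].
  have := PC x^-1; rewrite invr_ge0 ltW// => /(_ isT).
  rewrite hornerM hornerXn normrM ger0_norm; last by rewrite exprn_ge0 ?invr_ge0 ?ltW.
  rewrite exprVn ler_pdivrMl ?exprn_gt0// => H.
  rewrite normrM (ger0_norm (expR_ge0 _)) expRN ler_pdivrMr ?expR_gt0//.
  by rewrite mulrAC mulrC.
by rewrite normr0 mulr_ge0// sqr_ge0.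
Qed.

(** For [x > 0] the chain rule gives [p(1/x) exp(-1/x)] the derivative
    [x^-2 (p - p')(1/x) exp(-1/x)], which is again a polynomial in [1/x] times the exponential. *)
Definition dflat p : {poly R} := 'X^2 * (p - p^`()).

Lemma is_derive_flat p x : is_derive x 1 (flat p) (flat (dflat p) x).
Proof.
have [x0|x0|x0] := ltgtP 0 x.
- have E : {near x, (fun y : R => p.[y^-1] * expR (- y^-1)) =1 flat p}.
    near=> y; rewrite /flat ifT//; near: y; exact: lt_nbhsr.
  apply: (near_eq_is_derive E).
  have dV : is_derive x 1 (fun y : R => y^-1) (- x ^- 2).
    apply: is_derive_eq; first by apply: (is_deriveV (f := id)); rewrite gt_eqF.
    by rewrite -[LHS]/(_ * 1) mulr1.
  have dN : is_derive x 1 (fun y : R => - y^-1) (x ^- 2).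
    by apply: is_derive_eq; rewrite opprK.
  rewrite /flat x0 /dflat.
  have d1 := is_derive1_comp (g := fun y => y^-1) (is_derive_poly p x^-1) dV.
  have d2 := is_derive1_comp (g := fun y => - y^-1) (is_derive_expR (- x^-1)) dN.
  apply: (is_derive_eq (is_deriveM d1 d2)).
  transitivity (p.[x^-1] * (expR (- x^-1) / x ^+ 2) +
    expR (- x^-1) * (p^`().[x^-1] * - x ^- 2)) => //.
  rewrite hornerM hornerXn hornerD hornerN exprVn; ring.
- have E : {near x, cst 0 =1 flat p}.
    by near=> y; rewrite flat_le0// ltW//; near: y; exact: lt_nbhsl.
  apply: (near_eq_is_derive E).
  rewrite flat_le0 ?ltW//; exact: is_derive_cst.
(* At 0 the difference quotient is at most [C |h|] in absolute value. *)
rewrite -x0 flat_le0//; have [C PC] := flat_le_sqr p.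
have C0 : 0 <= C by have := le_trans (normr_ge0 _) (PC 1); rewrite expr1n mulr1.
(* [C] may be 0; [C + 1] can be divided by. *)
have C1 : 0 < C + 1 by rewrite ltr_wpDl.
have H : (fun h : R => h^-1 *: (flat p (h *: 1 + 0) - flat p 0)) @ 0^' --> (0 : R).
  apply/cvgrPdist_lt => e e0; near=> h.
  rewrite (flat_le0 p (lexx 0)) subr0 addr0 sub0r normrN normrZ [_ *: 1]mulr1.
  have h0 : h != 0 by near: h; exact: nbhs_dnbhs_neq.
  rewrite normfV ltr_pdivrMl ?normr_gt0//.
  apply: le_lt_trans (PC h) _.
  rewrite -real_normK ?num_real// expr2 mulrCA ltr_pM2l ?normr_gt0//.
  apply: le_lt_trans (_ : (C + 1) * `|h| < e); first by rewrite ler_wpM2r// lerDl.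
  rewrite -ltr_pdivlMl//; near: h; apply: dnbhs0_lt; rewrite mulr_gt0 ?invr_gt0//.
by apply: DeriveDef; [apply/cvg_ex; exists 0|exact: cvg_lim].
Unshelve. all: by end_near. Qed.

End flat.

(** * Functions of class C^m *)

Section class_C_theory.
Context {R : realType} {d : nat}.
Implicit Types (f g : 'rV[R]_d -> R).

(** Reduces a directional derivative to a derivative in one real variable, where the chain rule
    applies. *)
Lemma is_derive_line f x v D :
  is_derive (0 : R) 1 (fun h : R => f (h *: v + x)) D -> is_derive x v f D.
Proof.
move=> [dF DF].
have E : (fun h : R => h^-1 *: ((f \o shift x) (h *: v) - f x)) =
  (fun h : R => h^-1 *:
    (((fun h : R => f (h *: v + x)) \o shift 0) (h *: 1) - f (0 *: v + x))).
  by apply/funext => h; rewrite /= addr0 scale0r add0r [h *: 1]mulr1.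
split; first by rewrite /derivable E.
by rewrite /derive E.
Qed.

Lemma class_CS m f : class_C m.+1 f -> class_C m f.
Proof.
elim: m f => [|m IH] f; first by case.
by move=> [cf H]; split => // i; have [? /IH] := H i.
Qed.

Lemma class_C_continuous m f : class_C m f -> continuous f.
Proof. by case: m => [|m] // []. Qed.

Lemma class_C_cst m c : class_C m (cst c : 'rV[R]_d -> R).
Proof.
elim: m c => [|m IH] c /=; first by move=> x; exact: cst_continuous.
split; first by move=> x; exact: cst_continuous.
move=> i; split; first by move=> x; exact: derivable_cst.
rewrite (_ : partial i _ = cst 0); first exact: IH.
by apply/funext => x; rewrite /partial derive_cst.
Qed.

Lemma class_CD m f g : class_C m f -> class_C m g -> class_C m (f \+ g).
Proof.
elim: m f g => [|m IH] f g.
  by move=> cf cg x; apply: continuousD; [exact: cf|exact: cg].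
move=> [cf Hf] [cg Hg]; split.
  by move=> x; apply: continuousD; [exact: cf|exact: cg].
move=> i; have [df Cf] := Hf i; have [dg Cg] := Hg i.
split; first by move=> x; exact: derivableD.
rewrite (_ : partial i _ = partial i f \+ partial i g); first exact: IH.
by apply/funext => x; rewrite /partial deriveD.
Qed.

(** Induction on [m] through the product rule. Its terms pair a function with a derivative, so
    [class_CS] lowers the function to the class of the derivative. *)
Lemma class_CM m f g : class_C m f -> class_C m g -> class_C m (f \* g).
Proof.
elim: m f g => [|m IH] f g.
  by move=> cf cg x; apply: continuousM; [exact: cf|exact: cg].
move=> Hf' Hg'; have [cf Hf] := Hf'; have [cg Hg] := Hg'; split.
  by move=> x; apply: continuousM; [exact: cf|exact: cg].
move=> i; have [df Cf] := Hf i; have [dg Cg] := Hg i.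
split; first by move=> x; exact: derivableM.
rewrite (_ : partial i _ = (f \* partial i g) \+ (g \* partial i f)).
  by apply: class_CD; apply: IH => //; exact: class_CS.
by apply/funext => x; rewrite /partial deriveM.
Qed.

Lemma class_C_prod m (I : Type) (r : seq I) (F : I -> 'rV[R]_d -> R) :
  (forall i, class_C m (F i)) -> class_C m (fun x => \prod_(i <- r) F i x).
Proof.
move=> CF; elim: r => [|i r IH].
  under eq_fun do rewrite big_nil; exact: class_C_cst.
under eq_fun do rewrite big_cons; exact: class_CM.
Qed.

Lemma is_derive_flat_coord p c e i x v :
  is_derive x v (fun y : 'rV[R]_d => flat p (c * y 0 i + e))
    (c * v 0 i * flat (dflat p) (c * x 0 i + e)).
Proof.
apply: is_derive_line.
have -> : (fun h : R => flat p (c * (h *: v + x) 0 i + e)) =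
    flat p \o (fun h : R => (c * v 0 i) * h + (c * x 0 i + e)).
  by apply/funext => h; rewrite /= !mxE; congr flat; ring.
apply: is_derive_eq.
  apply: is_derive1_comp; first exact: is_derive_flat.
rewrite addr0 [_%:A]mulr1 mulr0 add0r; ring.
Qed.

(** The induction on [m] ranges over all [p], since each partial derivative is again of this form
    with [p] replaced by a multiple of [dflat p]. *)
Lemma class_C_flat m p c e i :
  class_C m (fun y : 'rV[R]_d => flat p (c * y 0 i + e)).
Proof.
have cf q : continuous (fun y : 'rV[R]_d => flat q (c * y 0 i + e)).
  move=> x; apply: (@continuous_comp _ _ _ (fun y : 'rV[R]_d => c * y 0 i + e)).
    apply: (@continuousD _ _ _ (fun y : 'rV[R]_d => c * y 0 i)); last
      exact: cst_continuous.
    apply: (@continuousM _ _ (cst c) (fun y : 'rV[R]_d => y 0 i)); first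
      exact: cst_continuous.
    exact: coord_continuous.
  apply: differentiable_continuous; apply/derivable1_diffP.
  by have [] := is_derive_flat q (c * x 0 i + e).
elim: m p => [|m IH] p; first exact: cf.
split; first exact: cf.
move=> j; have D x := is_derive_flat_coord p c e i x (delta_mx 0 j).
split; first by move=> x; have [] := D x.
rewrite (_ : partial j _ = (fun y : 'rV[R]_d =>
  flat ((c * (delta_mx 0 j : 'rV[R]_d) 0 i) *: dflat p) (c * y 0 i + e))).
  exact: IH.
by apply/funext => x; rewrite flatZ; have [_ <-] := D x.
Qed.

(** Along the [i]-th coordinate direction all factors but the [i]-th are constant. *)
Lemma is_derive_prod_coord (G G' : 'I_d -> R -> R) i (x : 'rV[R]_d) :
  (forall j (t : R), is_derive t (1 : R) (G j) (G' j t)) ->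
  is_derive x (delta_mx 0 i) (fun y : 'rV[R]_d => \prod_j G j (y 0 j))
    (\prod_j (if j == i then G' j else G j) (x 0 j)).
Proof.
move=> dG; apply: is_derive_line.
have -> : (fun h : R => \prod_j G j ((h *: delta_mx 0 i + x) 0 j)) =
   (\prod_(j | j != i) G j (x 0 j)) \*: (G i \o (fun h => h + x 0 i)).
  apply/funext => h; rewrite (bigD1 i)//= !mxE !eqxx mulr1 mulrC; congr (_ * _).
  by apply: eq_bigr => j ji; rewrite !mxE eqxx (negbTE ji) mulr0 add0r.
apply: is_derive_eq; rewrite add0r addr0 mulr1 [RHS](bigD1 i)//= eqxx mulrC.
congr (_ * _).
by apply: eq_bigr => j /negbTE ->.
Qed.

End class_C_theory.


(** * Bumps converging to indicators of boxes *)

Section bump.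
Context {R : realType}.

(** On []a, b[] this is [exp(-1/((n+1)(t-a))) exp(-1/((n+1)(b-t)))]. The arguments are written as
    [c * t + e] to match [class_C_flat] and [is_derive_flat_affine]. *)
Definition hat (a b : R) (n : nat) (t : R) : R :=
  flat 1 (n.+1%:R * t + - (n.+1%:R * a)) * flat 1 (- n.+1%:R * t + n.+1%:R * b).

Lemma flat1_ge0_le1 (x : R) : 0 <= flat 1 x <= 1.
Proof.
rewrite /flat; case: ifPn => [x0|]; rewrite ?lexx ?ler01// hornerC mul1r expR_ge0/=.
by rewrite -expR0 ler_expR oppr_le0 invr_ge0 ltW.
Qed.

(** For [x > 0] the exponent [-1/((n+1)x)] tends to 0, so the values tend to [exp 0 = 1]; for
    [x <= 0] they are all 0. *)
Lemma flat1_cvg (x : R) : flat 1 (n.+1%:R * x) @[n --> \oo] --> ((0 < x)%R%:R : R).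
Proof.
have [x0|x0] := leP x 0.
  rewrite (_ : (fun _ => _) = cst 0); first exact: cvg_cst.
  by apply/funext => n /=; rewrite flat_le0// pmulr_rle0.
rewrite (_ : (fun _ => _) = (fun n => expR (- (n.+1%:R^-1 * x^-1)))); last first.
  by apply/funext => n /=; rewrite /flat pmulr_rgt0// x0 hornerC mul1r invfM.
rewrite (_ : true%:R = expR (- (0 * x^-1))); last by rewrite mul0r oppr0 expR0.
apply: continuous_cvg; first exact: continuous_expR.
apply: cvgN; apply: cvgMl; exact: cvg_harmonic.
Qed.

Lemma hatE a b n t : hat a b n t =
  flat 1 (n.+1%:R * (t - a)) * flat 1 (n.+1%:R * (b - t)).
Proof. by rewrite /hat; congr (flat 1 _ * flat 1 _); ring. Qed.

Lemma hat_ge0_le1 a b n t : 0 <= hat a b n t <= 1.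
Proof.
have /andP[? ?] := flat1_ge0_le1 (n.+1%:R * t + - (n.+1%:R * a)).
have /andP[? ?] := flat1_ge0_le1 (- n.+1%:R * t + n.+1%:R * b).
by rewrite mulr_ge0//= mulr_ile1.
Qed.

Lemma hat_out a b n t : t \notin `]a, b[ -> hat a b n t = 0.
Proof.
rewrite hatE in_itv/= negb_and -!leNgt => /orP[h|h].
  by rewrite flat_le0 ?mul0r// pmulr_rle0// subr_le0.
by rewrite mulrC flat_le0 ?mul0r// pmulr_rle0// subr_le0.
Qed.

Lemma hat_cvg a b t : hat a b n t @[n --> \oo] --> ((t \in `]a, b[)%:R : R).
Proof.
under eq_fun do rewrite hatE.
rewrite in_itv/= -mulnb natrM -(subr_gt0 a) -(subr_gt0 t).
by apply: cvgM; exact: flat1_cvg.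
Qed.

Definition dhat (a b : R) (n : nat) (t : R) : R :=
  let x := n.+1%:R * t + - (n.+1%:R * a) in
  let y := - n.+1%:R * t + n.+1%:R * b in
  n.+1%:R * (flat (dflat 1) x * flat 1 y - flat 1 x * flat (dflat 1) y).

Lemma dhat_out a b n t : t \notin `]a, b[ -> dhat a b n t = 0.
Proof.
have xE : n.+1%:R * t + - (n.+1%:R * a) = n.+1%:R * (t - a) :> R by ring.
have yE : - n.+1%:R * t + n.+1%:R * b = n.+1%:R * (b - t) :> R by ring.
rewrite /dhat xE yE in_itv/= negb_and -!leNgt => /orP[h|h].
  by rewrite !(@flat_le0 _ _ (_ * (t - a))) ?mul0r ?subrr ?mulr0// pmulr_rle0// subr_le0.
by rewrite !(@flat_le0 _ _ (_ * (b - t))) ?mulr0 ?subrr ?mulr0// pmulr_rle0// subr_le0.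
Qed.

Lemma is_derive_flat_affine p (c e t : R) :
  is_derive t (1 : R) (fun y : R => flat p (c * y + e)) (c * flat (dflat p) (c * t + e)).
Proof.
have D : is_derive t (1 : R) (fun y : R => c * y + e) c.
  by apply: is_derive_eq; rewrite addr0 [LHS]mulr1.
rewrite mulrC.
exact: (is_derive1_comp (g := fun y => c * y + e) (is_derive_flat p (c * t + e)) D).
Qed.

Lemma is_derive_hat a b n (t : R) : is_derive t (1 : R) (hat a b n) (dhat a b n t).
Proof.
apply: (is_derive_eq (is_deriveM (is_derive_flat_affine 1 n.+1%:R (- (n.+1%:R * a)) t)
  (is_derive_flat_affine 1 (- n.+1%:R) (n.+1%:R * b) t))).
by rewrite /dhat /GRing.scale/=; ring.
Qed.

Lemma is_derive_continuous (f f' : R -> R) :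
  (forall t : R, is_derive t (1 : R) f (f' t)) -> continuous f.
Proof.
move=> df t; apply: differentiable_continuous; apply/derivable1_diffP.
by have [] := df t.
Qed.

Lemma continuous_flat_affine p (c e : R) : continuous (fun y : R => flat p (c * y + e)).
Proof. by apply: is_derive_continuous => t; exact: is_derive_flat_affine. Qed.

Lemma continuous_dhat a b n : continuous (dhat a b n).
Proof.
move=> t; apply: cvgM; first exact: cst_continuous.
by apply: cvgB; apply: cvgM; exact: continuous_flat_affine.
Qed.

Context {d : nat}.

Definition box_bump (a b : 'rV[R]_d) (n : nat) (x : 'rV[R]_d) : R :=
  \prod_i hat (a 0 i) (b 0 i) n (x 0 i).

Lemma bump_ge0_le1 a b n x : 0 <= box_bump a b n x <= 1.
Proof.
rewrite /box_bump; elim/big_rec : _ => [|i y _ /andP[y0 y1]]; first by rewrite ler01 lexx.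
have /andP[h0 h1] := hat_ge0_le1 (a 0 i) (b 0 i) n (x 0 i).
by rewrite mulr_ge0//= mulr_ile1.
Qed.

Lemma bump_out a b n x : ~ obox a b x -> box_bump a b n x = 0.
Proof.
move=> /existsNP[i /negP xi]; apply/eqP/prodf_eq0; exists i => //.
by rewrite hat_out.
Qed.

Lemma bump_cvg a b x : box_bump a b n x @[n --> \oo] --> (\1_(obox a b) x : R).
Proof.
have -> : \1_(obox a b) x = \prod_i (x 0 i \in `]a 0 i, b 0 i[)%:R :> R.
  rewrite indicE; have [xab|xab] := pselect (obox a b x).
    by rewrite mem_set// big1// => i _; rewrite xab.
  rewrite memNset//; apply/esym/eqP/prodf_eq0.
  by move: xab => /existsNP[i /negP/negbTE xi]; exists i => //; rewrite xi.
rewrite /box_bump; elim: (index_enum _) => [|i r IH].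
  by under eq_fun do rewrite big_nil; rewrite big_nil; exact: cvg_cst.
under eq_fun do rewrite big_cons; rewrite big_cons.
by apply: cvgM => //; exact: hat_cvg.
Qed.

Lemma class_C_bump m a b n : class_C m (box_bump a b n).
Proof.
apply: class_C_prod => i.
by apply: class_CM; exact: class_C_flat.
Qed.

(** The support lies in the closed box, which is compact. *)
Lemma test_function_bump (Om : set 'rV[R]_d) a b n :
  cbox a b `<=` Om -> test_function Om (box_bump a b n).
Proof.
move=> abOm; have S : closure [set x | box_bump a b n x != 0] `<=` cbox a b.
  rewrite [X in _ `<=` X](closure_id _).1; last exact: closed_cbox.
  apply: closure_subset => x /= /eqP bx; apply: obox_cbox.
  by apply: contrapT => /(bump_out n).
split; [by move=> m; exact: class_C_bump| |exact: subset_trans S _].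
exact: subclosed_compact (@closed_closure _ _) (@compact_cbox _ _ a b) S.
Qed.

Lemma partial_bump a b n i x : partial i (box_bump a b n) x =
  \prod_j (if j == i then dhat (a 0 j) (b 0 j) n else hat (a 0 j) (b 0 j) n) (x 0 j).
Proof.
rewrite /partial; have := is_derive_prod_coord i x
  (fun j t => is_derive_hat (a 0 j) (b 0 j) n t).
by case.
Qed.

Lemma partial_bump_out (a b : 'rV[R]_d) n i (x : 'rV[R]_d) : ~ obox a b x ->
  partial i (box_bump a b n) x = 0.
Proof.
move=> /existsNP[j /negP xj]; rewrite partial_bump; apply/eqP/prodf_eq0.
by exists j => //; case: ifP => _; rewrite ?dhat_out ?hat_out.
Qed.

End bump.

(** * Integration by parts against bumps *)

(** The product rule for the [i]-th partial derivative of two products over the coordinates, as an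
    algebraic identity: primes stand for derivatives. *)
Lemma prod_derivM (R : comPzRingType) (I : finType) (i : I) (f f' g g' : I -> R) :
  \prod_j (if j == i then f j * g' j + f' j * g j else f j * g j) =
  \prod_j f j * \prod_j (if j == i then g' j else g j) +
  \prod_j (if j == i then f' j else f j) * \prod_j g j.
Proof.
rewrite -!big_split/= (bigD1 i)//= [X in _ = X + _](bigD1 i)//=.
rewrite [X in _ = _ + X](bigD1 i)//= !eqxx mulrDl.
by congr (_ * _ + _ * _); apply: eq_bigr => j /negbTE ->.
Qed.

Section integration_by_parts.
Context {R : realType}.
Notation mu := (@lebesgue_measure R).

Lemma integrable_segment_support (f : R -> R) (a b : R) :
  continuous f -> (forall t, t \notin `[a, b] -> f t = 0) ->
  mu.-integrable setT (EFin \o f).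
Proof.
move=> cf f0; rewrite (_ : EFin \o f = (EFin \o f) \_ `[a, b]); last first.
  apply/funext => t; rewrite /patch; case: ifPn => // tab /=; rewrite f0//.
  by move: tab; rewrite notin_setE => /negP.
apply/(integrable_mkcond (mu := mu) (EFin \o f) (measurable_itv `[a, b])).
apply: continuous_compact_integrable; first exact: segment_compact.
exact: continuous_subspaceT.
Qed.

(** The fundamental theorem of calculus on a segment at whose ends [F] vanishes. *)
Lemma integral_derive_segment_support (F f : R -> R) (a b : R) :
  (forall t : R, is_derive t (1 : R) F (f t)) -> continuous f ->
  (forall t, t \notin `]a, b[ -> F t = 0) ->
  mu.-integrable setT (EFin \o f) /\ (\int[mu]_t (f t)%:E = 0)%E.
Proof.
(* [a < b] is not assumed, so the right end is replaced by a point beyond both [a] and [b]. *)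
move=> dF cf F0'; pose c := Num.max a b + 1.
have ac : a < c by rewrite ltr_pwDr// le_max lexx.
have F0 t : t \notin `]a, c[ -> F t = 0.
  move=> tac; apply: F0'; apply: contra tac; apply: subset_itvl.
  by rewrite bnd_simp ltW// ltr_pwDr// le_max lexx orbT.
(* Outside the closed segment [F] vanishes on a neighbourhood, hence so does its derivative. *)
have f0 t : t \notin `[a, c] -> f t = 0.
  move=> tac; have [_ <-] := dF t.
  rewrite -(derive_cst (0 : R) t (1 : R)); apply: near_eq_derive.
  have : nbhs t (~` `[a, c]%classic).
    apply: open_nbhs_nbhs; split; first exact/closed_openC/interval_closed.
    by move=> /= h; rewrite h in tac.
  apply: filterS => y /= yac; apply: F0; apply/negP => yac'; apply: yac.
  exact: subset_itv_oo_cc yac'.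
have If : mu.-integrable setT (EFin \o f) by exact: integrable_segment_support f0.
split=> //.
transitivity (\int[mu]_(t in `[a, c]) (f t)%:E)%E.
  rewrite [RHS]integral_mkcond; apply: eq_integral => t _; rewrite /patch.
  case: ifPn => // tac; rewrite f0//.
  by move: tac; rewrite notin_setE => /negP.
have cF := is_derive_continuous dF.
rewrite (continuous_FTC2 ac (F := F)).
- by rewrite !F0 ?subee// in_itv/= ltxx// andbF.
- exact: continuous_subspaceT.
- split; [by move=> t _; have [] := dF t|..].
    by apply: cvg_at_right_filter; exact: cF.
  by apply: cvg_at_left_filter; exact: cF.
- by move=> t _; rewrite derive1E; have [] := dF t.
Qed.

(** The factor that one coordinate contributes to a monomial times a bump. *)
Definition Xhat (m : nat) (a b : R) (n : nat) (t : R) := t ^+ m * hat a b n t.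

(** The derivative of [Xhat]; for [m = 0] the term with [m.-1] is cancelled by [*+ m]. *)
Definition dXhat (m : nat) (a b : R) (n : nat) (t : R) :=
  t ^+ m * dhat a b n t + (t ^+ m.-1 *+ m) * hat a b n t.

Lemma is_derive_Xn (m : nat) (t : R) :
  is_derive t (1 : R) (fun y : R => y ^+ m) (t ^+ m.-1 *+ m).
Proof.
case: m => [|m]; first by rewrite mulr0n; exact: is_derive_cst.
rewrite (_ : (fun _ => _) = (id : R -> R) ^+ m.+1); last first.
  by apply/funext => y; rewrite exprfctE.
by apply: is_derive_eq; rewrite [LHS]mulr1 mulr_natl.
Qed.

Lemma is_derive_Xhat m a b n (t : R) :
  is_derive t (1 : R) (Xhat m a b n) (dXhat m a b n t).
Proof.
apply: (is_derive_eq (is_deriveM (is_derive_Xn m t) (is_derive_hat a b n t))).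
by rewrite /dXhat; congr (_ + _); rewrite [LHS]mulrC.
Qed.

Lemma continuous_dXhat m a b n : continuous (dXhat m a b n).
Proof.
have cX k : continuous (fun t : R => t ^+ k).
  apply: is_derive_continuous => t; exact: is_derive_Xn.
have cX' : continuous (fun t : R => t ^+ m.-1 *+ m).
  rewrite (_ : (fun _ => _) = (fun t => m%:R * t ^+ m.-1)).
    move=> t; apply: (@continuousM _ _ (cst m%:R) (fun t : R => t ^+ m.-1)).
      exact: cst_continuous.
    exact: cX.
  by apply/funext => s; rewrite mulr_natl.
move=> t; apply: cvgD; apply: cvgM.
- exact: cX.
- exact: continuous_dhat.
- exact: cX'.
- apply: (is_derive_continuous (f := hat a b n)) => s; exact: is_derive_hat.
Qed.

Lemma Xhat_out m a b n t : t \notin `]a, b[ -> Xhat m a b n t = 0.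
Proof. by move=> /hat_out h; rewrite /Xhat h mulr0. Qed.

Context {d : nat}.
Implicit Types (p : mpoly d R) (x : 'rV[R]_d).
Notation mderiv := (@mpoly.mderiv d R).

Lemma pevalX (m : multinom d) x : peval (mpolyX R m) x = \prod_j x 0 j ^+ m j.
Proof. by rewrite /peval mevalX. Qed.

Lemma pevalDZ c p q x : peval (c *: p + q) x = c * peval p x + peval q x.
Proof. by rewrite /peval mevalD mevalZ. Qed.

Lemma peval_mderivX i (m : multinom d) x :
  peval (mderiv i (mpolyX R m)) x =
  \prod_j (if j == i then x 0 j ^+ (m j).-1 *+ m j else x 0 j ^+ m j).
Proof.
rewrite mderivX /peval mevalZ mevalX (bigD1 i)//= [RHS](bigD1 i)//= eqxx.
rewrite mnmBE mnm1E eqxx subn1 mulrA mulr_natl; congr (_ * _).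
by apply: eq_bigr => j ji; rewrite mnmBE mnm1E eq_sym (negbTE ji) subn0.
Qed.

(** The integrand is the [i]-th partial derivative of [p] times the bump. It is linear in [p], and
    for a monomial it is a product over the coordinates whose [i]-th factor is the derivative
    [dXhat], of integral 0. *)
Lemma integral_peval_bump p i (a b : 'rV[R]_d) n :
  let g x := peval p x * partial i (box_bump a b n) x +
             peval (mderiv i p) x * box_bump a b n x in
  (lebesgue_rV d).-integrable setT (EFin \o g) /\
  (\int[lebesgue_rV d]_x (g x)%:E = 0)%E.
Proof.
elim/mpolyind: p => [|c m p _ _ [I1 I2]] g.
  have -> : g = cst 0.
    by apply/funext => x; rewrite /g mderiv0 /peval mpoly.meval0 !mul0r addr0.
  split; first exact: integrable0.
  exact: integral0.
pose F j := if j == i then dXhat (m j) (a 0 j) (b 0 j) n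
  else Xhat (m j) (a 0 j) (b 0 j) n.
have IF j : mu.-integrable setT (EFin \o F j).
  rewrite /F; case: ifP => _.
    have [] // := integral_derive_segment_support (is_derive_Xhat (m j) (a 0 j) (b 0 j) n)
      (@continuous_dXhat (m j) (a 0 j) (b 0 j) n) (@Xhat_out (m j) (a 0 j) (b 0 j) n).
  apply: (@integrable_segment_support _ (a 0 j) (b 0 j)).
    exact: is_derive_continuous (is_derive_Xhat _ _ _ _).
  by move=> t h; apply: Xhat_out; apply: contra h; exact: subset_itv_oo_cc.
have [J1 J2] := integral_lebesgue_rV_prod IF.
have {}J2 : (\int[lebesgue_rV d]_x (\prod_i F i (x 0%R i))%:E = 0)%E.
  rewrite J2 (bigD1 i)//= /F eqxx /Rintegral.
  have [_ ->] := integral_derive_segment_support (is_derive_Xhat (m i) (a 0 i) (b 0 i) n)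
      (@continuous_dXhat (m i) (a 0 i) (b 0 i) n) (@Xhat_out (m i) (a 0 i) (b 0 i) n).
  by rewrite /= mul0r.
have gE : EFin \o g = (fun x => c%:E * (\prod_i F i (x 0%R i))%:E +
    (peval p x * partial i (box_bump a b n) x +
     peval (mderiv i p) x * box_bump a b n x)%:E)%E.
  apply/funext => x; rewrite /g /= -EFinM -EFinD; congr (_%:E).
  rewrite mderivD mderivZ !pevalDZ peval_mderivX pevalX partial_bump.
  rewrite (_ : \prod_j F j (x 0 j) = \prod_j x 0 j ^+ m j *
     \prod_j (if j == i then dhat (a 0 j) (b 0 j) n else hat (a 0 j) (b 0 j) n) (x 0 j) +
     (\prod_j (if j == i then x 0 j ^+ (m j).-1 *+ m j else x 0 j ^+ m j)) *
     box_bump a b n x).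
    by ring.
  pose X j := x 0 j ^+ m j; pose X' j := x 0 j ^+ (m j).-1 *+ m j.
  pose h j := hat (a 0 j) (b 0 j) n (x 0 j).
  pose h' j := dhat (a 0 j) (b 0 j) n (x 0 j).
  (* In this form [prod_derivM] separates the derivative of the monomial from that of the bump. *)
  rewrite (eq_bigr (fun j => if j == i then X j * h' j + X' j * h j else X j * h j)).
    rewrite prod_derivM; congr (_ * _ + _).
    by apply: eq_bigr => j _; case: ifP.
  by move=> j _; rewrite /F; case: ifP.
split; first by rewrite gE; apply: integrableD => //; exact: integrableZl.
rewrite -[LHS]/(integral _ _ (EFin \o g)) gE integralD//; last by exact: integrableZl.
rewrite integralZl// J2 mule0 add0e.
exact: I2.
Qed.

Lemma continuous_peval p : continuous (peval p).
Proof.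
elim/mpolyind: p => [|c m p _ _ IH].
  rewrite (_ : peval 0 = cst 0); first by move=> x; exact: cst_continuous.
  by apply/funext => y; rewrite /peval mpoly.meval0.
rewrite (_ : peval _ = (fun y => c * (\prod_j y 0 j ^+ m j) + peval p y)); last first.
  by apply/funext => y; rewrite pevalDZ pevalX.
move=> x; apply: (@continuousD _ _ _ (fun y : 'rV[R]_d => c * _)); last exact: IH.
apply: (@continuousM _ _ (cst c)); first exact: cst_continuous.
apply: (@class_C_continuous _ _ 0%N) => {x}.
apply: class_C_prod => j x.
apply: (continuous_comp (f := fun y : 'rV[R]_d => y 0 j) (g := fun t => t ^+ m j)).
  exact: coord_continuous.
exact: exprn_continuous.
Qed.

End integration_by_parts.

(** * Square-integrable functions *)

Lemma lee1_2 (R : realType) : (1 <= 2%:E :> \bar R)%E.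
Proof. by rewrite lee_fin ler1n. Qed.

Section L2_theory.
Context {R : realType} {d : nat}.
Variable Om : set 'rV[R]_d.
Hypothesis mOm : measurable Om.
Implicit Types f g u v w : 'rV[R]_d -> R.
Notation mu := (lebesgue_rV d).

Lemma L2_measurable f : L2 Om f -> measurable_fun setT (f \_ Om).
Proof. by rewrite /L2/= inE => /andP[]; rewrite inE. Qed.

Lemma L2_integrable_sqr f :
  L2 Om f -> mu.-integrable setT (EFin \o (fun x => (f \_ Om) x ^+ 2)).
Proof. exact: Lfun2_integrable_sqr. Qed.

Lemma L2P f : measurable_fun setT (f \_ Om) ->
  mu.-integrable setT (EFin \o (fun x => (f \_ Om) x ^+ 2)) -> L2 Om f.
Proof.
move=> mf /integrableP[_ fy]; rewrite /L2/= inE; apply/andP; split.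
  by rewrite inE.
rewrite inE/= /finite_norm unlock/=; apply: poweR_lty.
apply: le_lt_trans fy; rewrite le_eqVlt; apply/orP; left; apply/eqP.
apply: eq_integral => x _ /=.
by rewrite powR_mulrn// real_normK ?num_real// ger0_norm ?sqr_ge0.
Qed.

Lemma L2D f g : L2 Om f -> L2 Om g -> L2 Om (f \+ g).
Proof.
move=> Lf Lg; rewrite /L2/= (_ : _ \_ _ = f \_ Om + g \_ Om).
  exact: (Lfun_addr_closed _ (lee1_2 R)).2.
by apply/funext => x; rewrite fctE /patch; case: ifP => //; rewrite addr0.
Qed.

Lemma L2N f : L2 Om f -> L2 Om (\- f).
Proof.
move=> Lf; rewrite /L2/= (_ : _ \_ _ = - (f \_ Om)); first exact: Lfun_oppr_closed.
by apply/funext => x; rewrite fctE /patch; case: ifP => //; rewrite oppr0.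
Qed.

Lemma L2B f g : L2 Om f -> L2 Om g -> L2 Om (f \- g).
Proof. by move=> Lf Lg; apply: L2D => //; exact: L2N. Qed.

Lemma L2_bounded (M : R) f g : measurable_fun setT f ->
  (forall x, Om x -> `|f x| <= M) -> L2 Om g -> L2 Om (f \* g).
Proof.
move=> mf fM Lg.
have E : (f \* g) \_ Om = f \* (g \_ Om).
  by apply/funext => x; rewrite /= /patch; case: ifP => //; rewrite mulr0.
have mfg : measurable_fun setT ((f \* g) \_ Om).
  by rewrite E; apply: measurable_funM => //; exact: L2_measurable.
apply: L2P => //.
have := integrableZl measurableT (M ^+ 2) (L2_integrable_sqr Lg).
apply: le_integrable => //; first by apply/measurable_EFinP; exact: measurable_funX.
move=> x _; rewrite /comp -EFinM !abse_EFin lee_fin /patch; case: ifP => [|_].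
  rewrite inE => Ox; rewrite -[(f \* g) x]/(f x * g x) exprMn !normrM ler_wpM2r//.
  by rewrite ler_pM// (le_trans (fM x Ox))// ler_norm.
by rewrite /point/= expr0n/= mulr0.
Qed.

Lemma L2_inner_integrable f g :
  L2 Om f -> L2 Om g -> mu.-integrable Om (EFin \o (f \* g)).
Proof.
move=> Lf Lg; apply/(integrable_mkcond (mu := mu) _ mOm).
have /Lfun1_integrable := Lfun2_mul_Lfun1 Lf Lg.
congr (integrable _ _ _); apply/funext => x.
by rewrite /= /patch; case: ifP => //=; rewrite mulr0.
Qed.

Lemma inner0l f : inner Om (cst 0) f = 0.
Proof.
rewrite /inner; under eq_Rintegral do rewrite mul0r.
by rewrite Rintegral_cst// mul0r.
Qed.

Lemma innerDl f g h : L2 Om f -> L2 Om g -> L2 Om h ->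
  inner Om (f \+ g) h = inner Om f h + inner Om g h.
Proof.
move=> Lf Lg Lh; rewrite /inner -RintegralD//; try exact: L2_inner_integrable.
by apply: eq_Rintegral => x _; rewrite mulrDl.
Qed.

Lemma innerBl f g h : L2 Om f -> L2 Om g -> L2 Om h ->
  inner Om (f \- g) h = inner Om f h - inner Om g h.
Proof.
move=> Lf Lg Lh; rewrite /inner -RintegralB//; try exact: L2_inner_integrable.
by apply: eq_Rintegral => x _; rewrite mulrBl.
Qed.

(** Only the products with [h] have to agree: [f] and [g] may differ where [h] vanishes, as happens
    for a bump supported in one element. *)
Lemma inner_ae f g h : L2 Om f -> L2 Om g -> L2 Om h ->
  {ae mu, forall x, Om x -> f x * h x = g x * h x} -> inner Om f h = inner Om g h.
Proof.
move=> Lf Lg Lh fg; rewrite /inner /Rintegral; congr fine.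
have [mf _] := integrableP _ _ _ (L2_inner_integrable Lf Lh).
have [mg _] := integrableP _ _ _ (L2_inner_integrable Lg Lh).
apply: ae_eq_integral => //.
by apply: filterS fg => x h' Ox; rewrite h'.
Qed.

Lemma inner_sqr_eq0 f : L2 Om f -> inner Om f f = 0 ->
  {ae mu, forall x, Om x -> f x = 0}.
Proof.
move=> Lf f0; have If := L2_inner_integrable Lf Lf.
have f0' : (\int[mu]_(x in Om) `|(f x * f x)%:E| = 0)%E.
  rewrite (eq_integral (fun x => (f x * f x)%:E)); last first.
    by move=> x _; rewrite gee0_abs// lee_fin -expr2 sqr_ge0.
  rewrite -[LHS]fineK; last exact: (integrable_fin_num mOm If).
  by congr EFin; exact: f0.
have [mff _] := integrableP _ _ _ If.
have := (ae_eq_integral_abs mu mOm mff).1 f0'.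
apply: filterS => x /= h Ox; have := h Ox.
by move=> /eqP; rewrite eqe mulf_eq0 orbb => /eqP.
Qed.

End L2_theory.

(** * Functions orthogonal to all bumps *)

Section L2_open.
Context {R : realType} {d : nat}.
Variable Om : set 'rV[R]_d.
Hypotheses (mOm : measurable Om) (bOm : bounded_set Om).
Notation mu := (lebesgue_rV d).

Lemma continuous_bounded (f : 'rV[R]_d -> R) : continuous f ->
  exists M : R, forall x, Om x -> `|f x| <= M.
Proof.
move=> cf; have [M [_ bM]] := bOm; pose r := M + 1.
have : compact (f @` cbox (const_mx (- r)) (const_mx r)).
  by apply: continuous_compact; [exact: continuous_subspaceT|exact: compact_cbox].
move=> /compact_bounded[M' [_ bM']]; exists (M' + 1) => x Ox.
apply: (bM' (M' + 1)); rewrite ?ltrDl//; exists x => //.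
by apply: cbox_bound; apply: bM Ox; rewrite ltrDl.
Qed.

Lemma L2_cst (c : R) : L2 Om (cst c).
Proof.
apply: L2P.
  apply/(measurable_restrictT _ mOm); exact: measurable_cst.
rewrite (_ : EFin \o _ = (cst (c ^+ 2)%:E) \_ Om).
  apply/(integrable_mkcond (mu := mu) _ mOm).
  apply/integrableP; split; first exact: measurable_cst.
  rewrite integral_cst// lte_mul_pinfty ?abse_ge0//.
  exact: lebesgue_rV_bounded.
by apply/funext => x; rewrite /= /patch; case: ifP => //; rewrite /point/= expr0n.
Qed.

Lemma L2_continuous (f : 'rV[R]_d -> R) : continuous f -> L2 Om f.
Proof.
move=> cf; have [M fM] := continuous_bounded cf.
rewrite (_ : f = f \* (cst 1 : 'rV[R]_d -> R)).
  apply: (L2_bounded _ fM (L2_cst 1)); exact: continuous_measurable_rV.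
by apply/funext => x /=; rewrite mulr1.
Qed.

Variable w : 'rV[R]_d -> R.
Hypothesis Lw : L2 Om w.

Lemma L2_integrable : mu.-integrable Om (EFin \o w).
Proof.
have := L2_inner_integrable mOm Lw (L2_cst 1).
by congr (integrable _ _ _); apply/funext => x /=; rewrite mulr1.
Qed.

(** Dominated convergence: the bumps tend to the indicator of the box and lie between 0 and 1, so
    [|w|] dominates. It is integrable because [Om] is bounded. *)
Lemma integral_obox_eq0 a b : cbox a b `<=` Om ->
  (forall n, inner Om w (box_bump a b n) = 0) ->
  (\int[mu]_(x in obox a b) (w x)%:E = 0)%E.
Proof.
move=> abOm w0.
have Iw := L2_integrable; have [mw _] := integrableP _ _ _ Iw.
have mb n : measurable_fun setT (box_bump a b n).
  by apply: continuous_measurable_rV;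
    exact: (class_C_continuous (class_C_bump 0%N a b n)).
pose f_ n x := (w x * box_bump a b n x)%:E.
have wb n : (\int[mu]_(x in Om) f_ n x = 0)%E.
  rewrite -[LHS]fineK; first by have := w0 n; rewrite /inner/Rintegral => ->.
  apply: integrable_fin_num => //.
  apply: (L2_inner_integrable mOm Lw).
  apply: L2_continuous; exact: (class_C_continuous (class_C_bump 0%N a b n)).
pose g x := (w x * \1_(obox a b) x)%:E.
have m1 : measurable_fun setT (\1_(obox a b) : 'rV[R]_d -> R).
  by apply: measurable_indic; exact: measurable_obox.
have mf_ n : measurable_fun Om (f_ n).
  apply/measurable_EFinP; apply: measurable_funM; first exact/measurable_EFinP.
  exact: measurable_funTS.
have mg : measurable_fun Om g.
  apply/measurable_EFinP; apply: measurable_funM; first exact/measurable_EFinP.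
  exact: measurable_funTS.
have f_g : {ae mu, forall x, Om x -> f_ n x @[n --> \oo] --> g x}.
  apply: aeW => x Ox; apply: cvg_EFin; first exact: nearW.
  by apply: cvgMr; exact: bump_cvg.
have Iaw : mu.-integrable Om (fun x => `|(w x)%:E|%E) by exact: integrable_abse.
have fw : {ae mu, forall x n, Om x -> (`|f_ n x| <= `|(w x)%:E|)%E}.
  apply: aeW => x n Ox; rewrite /f_ !abse_EFin lee_fin normrM ler_piMr//.
  by have /andP[b0 b1] := bump_ge0_le1 a b n x; rewrite ger0_norm.
have [_ _] := dominated_convergence mOm mf_ mg f_g Iaw fw.
under eq_fun do rewrite wb.
move=> /cvg_lim; rewrite lim_cst// => /(_ (@ereal_hausdorff R)) g0.
have <- : Om `&` obox a b = obox a b.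
  by apply/seteqP; split => [x []//|x abx]; split => //; exact/abOm/obox_cbox.
rewrite integral_mkcondr g0.
apply: eq_integral => x _; rewrite /g /patch indicE.
by case: ifP => _; rewrite ?mulr1 ?mulr0.
Qed.

(** The integral of [w] over [A] intersected with the box is 0 when [A] is a box, hence for all
    measurable [A] by Dynkin's theorem; then [w] vanishes almost everywhere on the box. *)
Lemma L2_obox_eq0 a b : cbox a b `<=` Om ->
  (forall a' b' n, cbox a' b' `<=` cbox a b -> inner Om w (box_bump a' b' n) = 0) ->
  {ae mu, forall x, obox a b x -> w x = 0}.
Proof.
move=> abOm w0; have mQ := measurable_obox a b.
have QOm : obox a b `<=` Om by exact: subset_trans (@obox_cbox _ _ a b) abOm.
have Iw : mu.-integrable (obox a b) (EFin \o w).
  by apply: integrableS L2_integrable.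
have Iw' A : measurable A -> mu.-integrable (A `&` obox a b) (EFin \o w).
  by move=> mA; apply: integrableS Iw => //; exact: measurableI.
pose P A := (\int[mu]_(x in A `&` obox a b) (w x)%:E = 0)%E.
have PT : P setT.
  by rewrite /P setTI; apply: integral_obox_eq0 => // n; exact: w0.
have PA A : measurable A -> P A.
  rewrite {1}measurable_rV_obox.
  apply: (dynkin_induction measurable_rV_obox obox_setI_closed) => //.
  - move=> _ [[a' b'] _ <-] /=; rewrite /P setIC.
    have [a'' [b'' [-> H]]] := oboxI a b a' b'.
    apply: integral_obox_eq0; first exact: subset_trans H abOm.
    by move=> n; exact: w0.
  (* Complements: the integrals over [A] and over its complement add up to that over the whole
     box. *)
  - move=> {}A mA; rewrite /P => A0; move: PT; rewrite /P -(setUv A) setIUl.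
    rewrite integral_setU_EFin ?A0 ?add0e//.
    + exact: measurableI.
    + by apply: measurableI => //; exact: measurableC.
    + by rewrite -setIUl setUv setTI; case/integrableP: Iw => /measurable_EFinP.
    + rewrite disj_set2E; apply/eqP; rewrite setIACA setICr set0I//.
  move=> F mF tF F0; rewrite /P setI_bigcupl integral_bigcup//.
  - rewrite eseries0// => i _ _; exact: F0.
  - by apply: trivIset_setIr.
  - by move=> k; exact: measurableI.
  - by rewrite -setI_bigcupl; apply: Iw'; exact: bigcup_measurable.
have : ae_eq mu (obox a b) (EFin \o w) (cst 0%E).
  apply: integral_ae_eq => // E EQ mE.
  by rewrite integral0 -(setIidl EQ); exact: PA.
by apply: filterS => x /= h /h [].
Qed.

(** Countably many rational boxes cover [E], so the exceptional null sets can be united. With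
    [E = Om] this yields uniqueness of the divergence, with [E] an element its polynomial form
    there. *)
Lemma L2_open_eq0 (E : set 'rV[R]_d) : open E -> E `<=` Om ->
  (forall a b n, cbox a b `<=` E -> inner Om w (box_bump a b n) = 0) ->
  {ae mu, forall x, E x -> w x = 0}.
Proof.
move=> oE EOm w0.
pose I := ('rV[rat]_d * 'rV[rat]_d)%type.
(* The boxes are enumerated by their codes, as [ae_foralln] is indexed by natural numbers; a number
   that is no code imposes no condition. *)
have H (k : nat) : {ae mu, forall x, forall p : I, unpickle k = Some p ->
    cbox (rat_row p.1) (rat_row p.2) `<=` E ->
    obox (rat_row p.1) (rat_row p.2) x -> w x = 0}.
  case: unpickle => [p|]; last by apply: aeW.
  have [pE|pE] := pselect (cbox (@rat_row R d p.1) (rat_row p.2) `<=` E); last first.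
    by apply: aeW => x q [<-] /pE.
  have : {ae mu, forall x, obox (rat_row p.1) (rat_row p.2) x -> w x = 0}.
    apply: L2_obox_eq0; first exact: subset_trans pE EOm.
    by move=> a b n ab; apply: w0; exact: subset_trans ab pE.
  by apply: filterS => x h q [<-] _.
apply: filterS (ae_foralln H) => x h; rewrite {1}(open_bigcup_box oE).
by move=> [p /= pE px]; apply: h pE px; exact: pickleK.
Qed.

End L2_open.

(** * Weak divergence and discrete spaces *)

Section degrees.
Context {R : realType} {d : nat}.
Implicit Types (p q : mpoly d R).

Lemma total_degree_leB k p q :
  total_degree_le k p -> total_degree_le k q -> total_degree_le k (p - q).
Proof.
rewrite /total_degree_le => pk qk; apply: leq_trans (mmeasureD_le _ _ _) _.
by rewrite mmeasureN geq_max pk.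
Qed.

Lemma total_degree_leD k p q :
  total_degree_le k p -> total_degree_le k q -> total_degree_le k (p + q).
Proof.
rewrite /total_degree_le => pk qk; apply: leq_trans (mmeasureD_le _ _ _) _.
by rewrite geq_max pk.
Qed.

Lemma total_degree_le_sum k (I : Type) (r : seq I) (p : I -> mpoly d R) :
  (forall i, total_degree_le k (p i)) -> total_degree_le k (\sum_(i <- r) p i).
Proof.
move=> pk; elim/big_rec : _ => [|i q _ qk]; last exact: total_degree_leD.
by rewrite /total_degree_le mmeasure0.
Qed.

(** A monomial [m] of the derivative comes from the monomial [m + e_i] of [p], whose degree is one
    higher. *)
Lemma total_degree_le_mderiv k i p :
  total_degree_le k.+1 p -> total_degree_le k (mpoly.mderiv i p).
Proof.
rewrite /total_degree_le => pk; rewrite msizeE; apply/bigmax_leqP_seq => m + _.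
rewrite mcoeff_msupp mcoeff_deriv => h.
have : mnm_add m (mnm1 i) \in msupp p.
  by rewrite mcoeff_msupp; apply: contra h => /eqP ->; rewrite mul0rn.
move=> /msize_mdeg_lt /leq_trans/(_ pk); rewrite mdegD mdeg1 addn1.
by rewrite !ltnS.
Qed.

Lemma total_degree_leW k p : total_degree_le k p -> total_degree_le k.+1 p.
Proof. exact: leqW. Qed.

Lemma total_degree_leMX k i p :
  total_degree_le k p -> total_degree_le k.+1 (p * mpolyX R (mnm1 i)).
Proof.
rewrite /total_degree_le => pk.
(* The measure is the degree plus one but 0 for the zero polynomial, so the formula for products
   needs nonzero factors. *)
have [->|p0] := eqVneq p 0; first by rewrite mul0r mmeasure0.
rewrite msizeM//; last first.
  by apply/eqP => E; have := msizeX R (mnm1 i); rewrite E mmeasure0.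
by rewrite msizeX mdeg1 addnS/= addn1 ltnS.
Qed.

End degrees.

(** * The inner product of vector fields *)

Section vinner_theory.
Context {R : realType} {d : nat}.
Variable Om : set 'rV[R]_d.
Hypothesis mOm : measurable Om.
Implicit Types (s t : 'rV[R]_d -> 'rV[R]_d).

Lemma L2vecB s t : L2vec Om s -> L2vec Om t -> L2vec Om (s \- t).
Proof.
move=> Ls Lt i; have := L2B (Ls i) (Lt i).
by congr (L2 Om _); apply/funext => x /=; rewrite !mxE.
Qed.

Lemma vinnerE s t : L2vec Om s -> L2vec Om t ->
  vinner Om s t = \sum_i inner Om (fun x => s x 0 i) (fun x => t x 0 i).
Proof.
move=> Ls Lt; rewrite /vinner /inner /Rintegral.
have I i : (lebesgue_rV d).-integrable Om (fun x => (s x 0 i * t x 0 i)%:E).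
  exact: (L2_inner_integrable mOm (Ls i) (Lt i)).
under eq_integral do rewrite /dot -sumEFin.
rewrite integral_sum// -[RHS]/(fine (\sum_i fine _)%:E) -sumEFin; congr fine.
by apply: eq_bigr => i _; rewrite fineK//; exact: (integrable_fin_num mOm (I i)).
Qed.

Lemma vinnerBl s1 s2 t : L2vec Om s1 -> L2vec Om s2 -> L2vec Om t ->
  vinner Om (s1 \- s2) t = vinner Om s1 t - vinner Om s2 t.
Proof.
move=> L1 L2 Lt; rewrite !vinnerE//; last exact: L2vecB.
rewrite -sumrB; apply: eq_bigr => i _; rewrite -innerBl//.
by congr inner; apply/funext => x /=; rewrite !mxE.
Qed.

End vinner_theory.

(** * Weak divergence, discrete spaces and projection *)

Section divergence.
Context {R : realType} {d : nat}.
Variable Om : set 'rV[R]_d.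
Hypotheses (oOm : open Om) (bOm : bounded_set Om).
Implicit Types (s t : 'rV[R]_d -> 'rV[R]_d) (g : 'rV[R]_d -> R).
Notation mu := (lebesgue_rV d).

Let mOm : measurable Om. Proof. exact: open_measurable_rV. Qed.

Lemma L2_test_function phi : test_function Om phi -> L2 Om phi.
Proof.
by move=> [C _ _]; apply: L2_continuous => //; exact: (class_C_continuous (C 0%N)).
Qed.

Lemma L2vec_gradient phi : test_function Om phi -> L2vec Om (gradient phi).
Proof.
move=> [C _ _] i; have [_ /(_ i)[_ Ci]] := C 1%N.
have := L2_continuous mOm bOm (class_C_continuous (m := 0) Ci).
by congr (L2 Om _); apply/funext => x; rewrite mxE.
Qed.

Lemma is_divergenceB s t g h : L2vec Om s -> L2vec Om t ->
  is_divergence Om s g -> is_divergence Om t h ->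
  is_divergence Om (s \- t) (g \- h).
Proof.
move=> Ls Lt [Lg Hg] [Lh Hh]; split; first exact: L2B.
move=> phi tphi; have Lp := L2_test_function tphi; have Lgr := L2vec_gradient tphi.
by rewrite vinnerBl// innerBl// Hg// Hh// opprB opprK addrC.
Qed.

(** Membership in H(div) provides a divergence, so [xget] does not fall back on its default 0. *)
Lemma weak_divP s : Hdiv Om s -> is_divergence Om s (weak_div Om s).
Proof. by move=> [_ Hs]; exact: (xgetPex (cst 0) Hs). Qed.

Lemma HdivB s t : Hdiv Om s -> Hdiv Om t -> Hdiv Om (s \- t).
Proof.
move=> Hs Ht; have [[Ls _] [Lt _]] := (Hs, Ht); split; first exact: L2vecB.
by eexists; apply: is_divergenceB => //; exact: weak_divP.
Qed.

(** Bumps on closed boxes in [Om] are test functions, so the difference is orthogonal to all of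
    them. *)
Lemma is_divergence_unique s g h : is_divergence Om s g -> is_divergence Om s h ->
  {ae mu, forall x, Om x -> g x = h x}.
Proof.
move=> [Lg Hg] [Lh Hh].
have : {ae mu, forall x, Om x -> (g \- h) x = 0}.
  apply: (@L2_open_eq0 _ _ Om mOm bOm _ _ Om) => //; first exact: L2B.
  move=> a b n abOm; have tb := test_function_bump n abOm.
  rewrite innerBl//; last exact: L2_test_function.
  by apply/eqP; rewrite subr_eq0 -eqr_opp -Hg// -Hh.
by apply: filterS => x h0 Ox; apply/eqP; rewrite -subr_eq0; exact/eqP/h0.
Qed.

(** [weak_div] is a chosen representative, so additivity holds almost everywhere, through
    uniqueness. *)
Lemma weak_divB s t : Hdiv Om s -> Hdiv Om t ->
  {ae mu, forall x, Om x -> weak_div Om (s \- t) x = weak_div Om s x - weak_div Om t x}.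
Proof.
move=> Hs Ht; have [[Ls _] [Lt _]] := (Hs, Ht).
apply: is_divergence_unique; first exact/weak_divP/HdivB.
by apply: is_divergenceB => //; exact: weak_divP.
Qed.

Lemma L2_peval p : L2 Om (peval p).
Proof. by apply: L2_continuous => //; exact: continuous_peval. Qed.

Lemma inner_peval_bump p i a b n : cbox a b `<=` Om ->
  inner Om (peval p) (partial i (box_bump a b n)) =
  - inner Om (peval (mpoly.mderiv i p)) (box_bump a b n).
Proof.
move=> abOm; have tb := test_function_bump n abOm.
have Lb := L2_test_function tb.
have Lpb : L2 Om (partial i (box_bump a b n)).
  by have := L2vec_gradient tb i; congr (L2 Om _); apply/funext => x; rewrite mxE.
have I1 := L2_inner_integrable mOm (L2_peval p) Lpb.
have I2 := L2_inner_integrable mOm (L2_peval (mpoly.mderiv i p)) Lb.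
apply/eqP; rewrite -addr_eq0 /inner -RintegralD//.
(* Outside [Om] the bump and its derivative vanish, so the integral may be taken over the whole
   space. *)
rewrite Rintegral_mkcond; have [_ E0] := integral_peval_bump p i a b n.
apply/eqP; transitivity (fine (0 : \bar R)) => //; rewrite -E0; congr fine.
apply: eq_integral => x _; rewrite /patch; case: ifPn => // xOm.
have xab : ~ obox a b x.
  by move=> /obox_cbox/abOm xO; move: xOm; rewrite notin_setE; exact.
by rewrite bump_out// partial_bump_out// !mulr0 addr0.
Qed.

Variables (N : nat) (T : @mesh R d N).
Hypothesis TOm : forall j, elt T j `<=` Om.

(** The components of [q(x) x] are [q X_i], of degree at most [k + 1]. Divergences in both families
    can thus be treated at once. *)
Lemma RT_BDM k : RT Om T k `<=` BDM Om T k.+1.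
Proof.
move=> t [Ht tp]; split => // j; have [p [q [pk qk tE]]] := tp j.
exists (fun i => p i + q * mpolyX R (mnm1 i)).
  move=> i; apply: total_degree_leD; first exact: total_degree_leW.
  exact: total_degree_leMX.
apply: filterS tE => x h xj; rewrite (h xj); apply/rowP => i; rewrite !mxE.
by rewrite /peval mevalD mevalM mevalXU.
Qed.

(** Bumps supported in one element see only the polynomial that [t] equals there, so on that element
    the weak divergence is the classical divergence [D], of degree at most [k]. *)
Lemma weak_div_Dh k t : BDM Om T k.+1 t -> Dh Om T k (weak_div Om t).
Proof.
move=> [Ht tp]; have [Lg Hg] := weak_divP Ht; have [Lt _] := Ht.
split => // j; have [p pk tE] := tp j.
exists (\sum_i mpoly.mderiv i (p i)).
  by apply: total_degree_le_sum => i; exact: total_degree_le_mderiv.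
set D := \sum_i _.
have : {ae mu, forall x, elt T j x -> (weak_div Om t \- peval D) x = 0}.
  apply: (@L2_open_eq0 _ _ Om mOm bOm) => //.
  - by apply: L2B => //; exact: L2_peval.
  - exact: open_interior.
  move=> a b n abE; have abOm : cbox a b `<=` Om by exact: subset_trans abE (@TOm j).
  have tb := test_function_bump n abOm; have Lb := L2_test_function tb.
  rewrite innerBl//; last exact: L2_peval.
  apply/eqP; rewrite subr_eq0 -eqr_opp -Hg//; apply/eqP.
  rewrite vinnerE//; last exact: L2vec_gradient.
  have Lpb i : L2 Om (partial i (box_bump a b n)).
    by have := L2vec_gradient tb i; congr (L2 Om _); apply/funext => x; rewrite mxE.
  transitivity (\sum_i - inner Om (peval (mpoly.mderiv i (p i))) (box_bump a b n)).
    apply: eq_bigr => i _; rewrite -inner_peval_bump//.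
    rewrite (_ : (fun x => gradient _ x 0 i) = partial i (box_bump a b n)); last first.
      by apply/funext => x; rewrite mxE.
    apply: inner_ae => //; first exact: L2_peval.
    (* In the box [t] is polynomial; outside it the derivative of the bump is 0. *)
    apply: filterS tE => x h Ox; have [xab|xab] := pselect (obox a b x).
      by rewrite h ?mxE//; exact/abE/obox_cbox.
    by rewrite partial_bump_out// !mulr0.
  rewrite sumrN; congr (- _); rewrite /D.
  elim: (index_enum _) => [|i r IH].
    rewrite !big_nil -[LHS](inner0l mOm (box_bump a b n)).
    by congr inner; apply/funext => x; rewrite /peval mpoly.meval0.
  rewrite !big_cons IH -innerDl//; [|exact: L2_peval..].
  by congr inner; apply/funext => x; rewrite /peval mevalD.
by apply: filterS => x h xj; apply/eqP; rewrite -subr_eq0; exact/eqP/h.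
Qed.

Lemma DhB k v w : Dh Om T k v -> Dh Om T k w -> Dh Om T k (v \- w).
Proof.
move=> [Lv Hv] [Lw Hw]; split; first exact: L2B.
move=> j; have [p pk vE] := Hv j; have [q qk wE] := Hw j.
exists (p - q); first exact: total_degree_leB.
apply: filterS2 vE wE => x h1 h2 xj.
by rewrite /= h1// h2// /peval mevalB.
Qed.

Lemma RTB k s t : RT Om T k s -> RT Om T k t -> RT Om T k (s \- t).
Proof.
move=> [Hs sp] [Ht tp]; split; first exact: HdivB.
move=> j; have [p [q [pk qk sE]]] := sp j; have [p' [q' [pk' qk' tE]]] := tp j.
exists (fun i => p i - p' i), (q - q'); split.
- by move=> i; exact: total_degree_leB.
- exact: total_degree_leB.
apply: filterS2 sE tE => x h1 h2 xj.
rewrite /= h1// h2//; apply/rowP => i; rewrite !mxE /peval !mevalB; ring.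
Qed.

Lemma BDMB k s t : BDM Om T k s -> BDM Om T k t -> BDM Om T k (s \- t).
Proof.
move=> [Hs sp] [Ht tp]; split; first exact: HdivB.
move=> j; have [p pk sE] := sp j; have [p' pk' tE] := tp j.
exists (fun i => p i - p' i); first by move=> i; exact: total_degree_leB.
apply: filterS2 sE tE => x h1 h2 xj.
by rewrite /= h1// h2//; apply/rowP => i; rewrite !mxE /peval !mevalB.
Qed.

(** [g] shows that a projection exists, so [Qh] is one. The difference of two projections lies in
    [Dh] and is orthogonal to [Dh], hence to itself. *)
Lemma Qh_ae k f g : Dh Om T k g -> L2 Om f ->
  (forall v, Dh Om T k v -> inner Om g v = inner Om f v) ->
  {ae mu, forall x, Om x -> Qh Om T k f x = g x}.
Proof.
move=> Dg Lf Hg.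
have [DQ HQ] : [set q | Dh Om T k q /\
    forall v, Dh Om T k v -> inner Om q v = inner Om f v]
    (Qh Om T k f).
  by apply: xgetPex; exists g.
have Dw := DhB DQ Dg; have [[LQ _] [Lg _] [Lw _]] := And3 DQ Dg Dw.
have : {ae mu, forall x, Om x -> (Qh Om T k f \- g) x = 0}.
  apply: inner_sqr_eq0 => //.
  by rewrite innerBl// HQ// Hg// subrr.
by apply: filterS => x h Ox; apply/eqP; rewrite -subr_eq0; exact/eqP/h.
Qed.

End divergence.

(** * Orthogonality *)

Section orthogonality.
Context {R : realType} {d : nat}.
Variable Om : set 'rV[R]_d.
Hypothesis mOm : measurable Om.
(** [beta] stands for the inverse of the coefficient [alpha]. *)
Variables (beta : 'rV[R]_d -> R) (M : R).
Hypotheses (mbeta : measurable_fun setT beta) (betaM : forall x, `|beta x| <= M)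
  (beta0 : forall x, 0 <= beta x).
Implicit Types (s t : 'rV[R]_d -> 'rV[R]_d).

Lemma L2vec_scale s : L2vec Om s -> L2vec Om (fun x => beta x *: s x).
Proof.
move=> Ls i; have := L2_bounded mbeta (fun x _ => betaM x) (Ls i).
by congr (L2 Om _); apply/funext => x; rewrite mxE.
Qed.

Lemma vinnerC s t : vinner Om s t = vinner Om t s.
Proof.
by apply: eq_Rintegral => x _; apply: eq_bigr => i _; rewrite mulrC.
Qed.

Lemma vinner_scaleC s t :
  vinner Om (fun x => beta x *: s x) t = vinner Om (fun x => beta x *: t x) s.
Proof.
by apply: eq_Rintegral => x _; apply: eq_bigr => i _; rewrite !mxE mulrAC.
Qed.

Lemma vinner_scale_ge0 s : 0 <= vinner Om (fun x => beta x *: s x) s.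
Proof.
apply: Rintegral_ge0 => x _; apply: sumr_ge0 => i _.
by rewrite mxE -mulrA mulr_ge0// -expr2 sqr_ge0.
Qed.

Lemma scale_subE s t : (fun x => beta x *: (s \- t) x) =
  (fun x => beta x *: s x) \- (fun x => beta x *: t x).
Proof. by apply/funext => x; rewrite scalerBr. Qed.

(** Pythagoras in the inner product weighted by [beta]: by symmetry both cross terms vanish, which
    leaves the nonnegative square of [t] as the difference of the two sides. *)
Lemma vinner_le_orthogonal e t : L2vec Om e -> L2vec Om t ->
  vinner Om (fun x => beta x *: e x) t = 0 ->
  vinner Om (fun x => beta x *: e x) e <=
  vinner Om (fun x => beta x *: (e \- t) x) (e \- t).
Proof.
move=> Le Lt et0; have Lbe := L2vec_scale Le; have Lbt := L2vec_scale Lt.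
have Let := L2vecB Le Lt.
rewrite scale_subE vinnerBl// ![vinner Om _ (e \- t)]vinnerC !vinnerBl//.
rewrite ![vinner Om _ (fun x => beta x *: e x)]vinnerC.
rewrite ![vinner Om _ (fun x => beta x *: t x)]vinnerC.
rewrite [vinner Om _ e in X in _ - X]vinner_scaleC et0 subr0 sub0r opprK lerDl.
exact: vinner_scale_ge0.
Qed.

(** The square of [(sqrt alpha)^-1] is [alpha^-1], also where [alpha] is 0, by the convention on
    inverses. *)
Lemma weighted_normE (alpha : 'rV[R]_d -> R) s :
  (forall x, 0 <= alpha x) -> (forall x, (alpha x)^-1 = beta x) ->
  weighted_norm Om alpha s = Num.sqrt (vinner Om (fun x => beta x *: s x) s).
Proof.
move=> a0 ab; congr Num.sqrt; apply: eq_Rintegral => x _.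
apply: eq_bigr => i _; rewrite !mxE mulrACA -invfM -expr2 sqr_sqrtr// ab.
by rewrite mulrA.
Qed.

End orthogonality.

(** * Piecewise constant coefficients *)

Section piecewise.
Context {R : realType} {d n : nat}.
Variable Omi : 'I_n -> set 'rV[R]_d.
Implicit Types (a : 'I_n -> R) (x : 'rV[R]_d).

Lemma piecewise_cst_ge0 a x : (forall i, 0 <= a i) -> 0 <= piecewise_cst Omi a x.
Proof. by move=> a0; apply: sumr_ge0 => i _; rewrite mulr_ge0. Qed.

Lemma piecewise_cst_bounded a x : `|piecewise_cst Omi a x| <= \sum_i `|a i|.
Proof.
apply: le_trans (ler_norm_sum _ _ _) _; apply: ler_sum => i _.
by rewrite normrM ler_piMr// indicE; case: (_ \in _); rewrite ?normr1 ?normr0.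
Qed.

Lemma measurable_piecewise_cst a : (forall i, open (Omi i)) ->
  measurable_fun setT (piecewise_cst Omi a).
Proof.
move=> oO; apply: measurable_sum => i; apply: measurable_funM => //.
by apply: measurable_indic; exact: open_measurable_rV.
Qed.

(* Outside the subdomains both sides are 0, as 0^-1 = 0. *)
Lemma piecewise_cstV a x : (forall i j, i != j -> Omi i `&` Omi j = set0) ->
  (piecewise_cst Omi a x)^-1 = piecewise_cst Omi (fun i => (a i)^-1) x.
Proof.
move=> dO; rewrite /piecewise_cst.
have [[i xi]|nx] := pselect (exists i, Omi i x); last first.
  by rewrite !big1 ?invr0// => i _; rewrite indicE memNset ?mulr0// => xi;
    apply: nx; exists i.
have H (b : 'I_n -> R) : \sum_j b j * \1_(Omi j) x = b i.
  rewrite (bigD1 i)//= big1 => [|j ji]; first by rewrite indicE mem_set// mulr1 addr0.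
  rewrite indicE memNset ?mulr0// => xj.
  by have := dO j i ji; rewrite -subset0 => /(_ x); apply.
by rewrite !H.
Qed.

End piecewise.

(** * Minimality of the discrete flux error *)

Theorem theorem3p2 (R : realType) (d : nat) (hd : d = 2%N \/ d = 3%N)
  (Om : set 'rV[R]_d) (hOm : polyhedral_domain Om)
  (n : nat) (Omi : 'I_n -> set 'rV[R]_d) (hOmi : polyhedral_partition Om Omi)
  (a : 'I_n -> R) (ha : forall i, 0 < a i)
  (f : 'rV[R]_d -> R) (hf : L2 Om f)
  (N : nat) (T : @mesh R d N) (hT : triangulation Om T)
  (kappa : R) (hreg : shape_regular kappa T)
  (hint : resolves_interfaces Omi T)
  (k : nat) (Sigma : set ('rV[R]_d -> 'rV[R]_d))
  (hSigma : Sigma = RT Om T k \/ Sigma = BDM Om T k.+1)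
  (s : 'rV[R]_d -> 'rV[R]_d) (u : 'rV[R]_d -> R)
  (hM : mixed_solution Om (Hdiv Om) (L2 Om) (piecewise_cst Omi a) f s u)
  (sh : 'rV[R]_d -> 'rV[R]_d) (uh : 'rV[R]_d -> R)
  (hMh : mixed_solution Om Sigma (Dh Om T k) (piecewise_cst Omi a) f sh uh) :
  ((weighted_norm Om (piecewise_cst Omi a) (s \- sh))%:E <=
   ereal_inf [set (weighted_norm Om (piecewise_cst Omi a) (s \- t))%:E
             | t in Sigma_f Om T Sigma k f])%E.
Proof.
have [_ oOm _ bOm _] := hOm.
have mOm : measurable Om by exact: open_measurable_rV.
have [pOmi _ dOmi _] := hOmi.
have oOmi i : open (Omi i) by have [] := pOmi i.
have [_ _ _ TOm _] := hT.
have [Hs Lu HM _] := hM; have [Ssh Duh HMh HMh2] := hMh.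
pose beta := piecewise_cst Omi (fun i => (a i)^-1).
have ab x : (piecewise_cst Omi a x)^-1 = beta x by exact: piecewise_cstV.
have a0 x : 0 <= piecewise_cst Omi a x.
  by apply: piecewise_cst_ge0 => i; exact/ltW/ha.
have b0 x : 0 <= beta x.
  by apply: piecewise_cst_ge0 => i; rewrite invr_ge0; exact/ltW/ha.
have mb : measurable_fun setT beta by exact: measurable_piecewise_cst.
have bM := piecewise_cst_bounded Omi (fun i => (a i)^-1).
(* From here the two choices of [Sigma] are handled together, through this inclusion and closure
   under subtraction of [sh]. *)
have SigmaBDM : Sigma `<=` BDM Om T k.+1.
  by case: hSigma => ->; [exact: RT_BDM|].
have SigmaB t : Sigma t -> Sigma (t \- sh).
  by case: hSigma Ssh => ->; [move=> ? ?; exact: RTB|move=> ? ?; exact: BDMB].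
have Hsh : Hdiv Om sh by have [] := SigmaBDM _ Ssh.
(* By the second discrete equation [weak_div Om sh], which lies in [Dh], has the defining property
   of the projection of [f]. *)
have divsh : {ae lebesgue_rV d, forall x, Om x -> Qh Om T k f x = weak_div Om sh x}.
  by apply: Qh_ae => //; apply: weak_div_Dh => //; exact: SigmaBDM.
apply: le_ereal_inf_tmp => _ [t [St divt] <-]; rewrite lee_fin.
have Ht : Hdiv Om t by have [] := SigmaBDM _ St.
have Ste := SigmaB _ St; have He : Hdiv Om (t \- sh) by have [] := SigmaBDM _ Ste.
have [[Ls _] [Lsh _] [Le _]] := And3 Hs Hsh He.
have div0 : {ae lebesgue_rV d, forall x, Om x -> weak_div Om (t \- sh) x = 0}.
  apply: filterS3 (weak_divB oOm bOm Ht Hsh) divt divsh => x h1 h2 h3 Ox.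
  by rewrite h1// h2// h3// subrr.
(* Taken at [u] and at [uh], this removes the divergence terms from the two first equations. *)
have inner0 v : L2 Om v -> inner Om (weak_div Om (t \- sh)) v = 0.
  move=> Lv; have [Lw _] := weak_divP He.
  rewrite -[RHS](inner0l mOm v); apply: inner_ae => //; first exact: L2_cst.
  by apply: filterS div0 => x h Ox; rewrite h.
have orth : vinner Om (fun x => beta x *: (s \- sh) x) (t \- sh) = 0.
  have Lbs := L2vec_scale mb bM.
  rewrite scale_subE vinnerBl//; [|exact: Lbs..].
  (* [t - sh] lies in H(div) and in [Sigma], so it is admissible in the continuous and in the
     discrete equation. *)
  have /eqP := HM _ He; rewrite inner0// subr0 => /eqP.
  under eq_fun do rewrite ab; move=> ->.
  have /eqP := HMh _ Ste; rewrite inner0; last by have [] := Duh.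
  rewrite subr0 => /eqP.
  by under eq_fun do rewrite ab; move=> ->; rewrite subr0.
rewrite !(weighted_normE _ _ a0 ab); apply: ler_wsqrtr.
rewrite (_ : s \- t = (s \- sh) \- (t \- sh)); last first.
  by apply/funext => x /=; rewrite opprB addrA subrK.
by apply: (vinner_le_orthogonal mOm mb bM b0) => //; exact: L2vecB.
Qed.
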